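(* Let $p$ be a prime, $0<\epsilon<1$, and $k$ a positive integer. For each $n$, let $1\le\alpha_n^{(k)}<\alpha_n^{(k-1)}<\cdots<\alpha_n^{(1)}\le n$ and $n\ge\beta_n^{(k)}>\beta_n^{(k-1)}>\cdots>\beta_n^{(1)}\ge1$ be integers, and let $M$ be an $\epsilon$-balanced random $n\times n$ matrix over $\mathbb{Z}_p$ having $k$-step stairs of $0$ with respect to $\alpha_n^{(i)}$ and $\beta_n^{(i)}$. Suppose that for every $1\le i\le k$, $\lim_{n\to\infty}(n-\alpha_n^{(i)}-\beta_n^{(i)})=\infty$. Then for every finite abelian $p$-group $G$, $$\lim_{n\to\infty}\mathbb{P}(\mathrm{cok}(M)\cong G)=\frac{1}{|\mathrm{Aut}(G)|}\prod_{i=1}^\infty(1-p^{-i}).$$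
   Context: A random variable $\xi$ in $\mathbb{Z}_p$ is $\epsilon$-balanced if for every $r\in\mathbb{Z}/p\mathbb{Z}$, $\mathbb{P}(\xi\equiv r \pmod p)\le 1-\epsilon$. A random $n\times n$ matrix $M$ is an $\epsilon$-balanced random matrix having $k$-step stairs of $0$ with respect to $\alpha_n^{(i)}$ and $\beta_n^{(i)}$ if $M_{i,j}=0$ whenever there is $1\le l\le k$ with $1\le i\le\alpha_n^{(l)}$ and $1\le j\le\beta_n^{(l)}$, and all other entries of $M$ are independent $\epsilon$-balanced random variables. *)

(* Defs.v *)
From HB Require Import structures.
From mathcomp Require Import all_boot all_order all_algebra all_fingroup all_solvable.
From mathcomp Require Import all_classical all_reals all_analysis.

Set Implicit Arguments.
Unset Strict Implicit.
Unset Printing Implicit Defensive.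

Import Order.TTheory GRing.Theory Num.Theory.
Import numFieldNormedType.Exports.

Local Open Scope classical_set_scope.
Local Open Scope ring_scope.

(* The p-adic integers as the inverse limit of the rings Z/p^(m+1).  The index
   is shifted because 'Z_(p ^ 0) is not the zero ring but 'Z_2.  The type is
   meaningful for p prime; for p < 2 it is still a ring, by the conventions on
   'Z_0 and 'Z_1. *)
Record padic (p : nat) := Padic {
  padic_seq : forall m, 'Z_(p ^ m.+1);
  padic_seqP : forall m,
    ((padic_seq m.+1 : nat)%:R : 'Z_(p ^ m.+1)) = padic_seq m
}.

Definition padic_res (p m : nat) (x : padic p) : 'Z_(p ^ m.+1) := padic_seq x m.

HB.instance Definition _ (p : nat) := gen_eqMixin (padic p).
HB.instance Definition _ (p : nat) := gen_choiceMixin (padic p).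

Section PadicRing.
Variable p : nat.
Implicit Types x y z : padic p.

Lemma padicP x y : (forall m, padic_res m x = padic_res m y) -> x = y.
Proof.
case: x y => [f fP] [g gP] /= fg.
have {}fg : f = g by apply: functional_extensionality_dep.
by case: g / fg gP => gP; congr Padic; exact: Prop_irrelevance.
Qed.

Let Zdiv m : ((Zp_trunc (p ^ m.+1)).+2 %| (Zp_trunc (p ^ m.+2)).+2)%N.
Proof.
case: p => [|[|q]]; first by rewrite !exp0n.
  by rewrite !exp1n.
by rewrite !Zp_cast ?dvdn_exp2l // -[1%N](expn0 q.+2) ltn_exp2l.
Qed.

Let red m (a : nat) :
  ((a %% (Zp_trunc (p ^ m.+2)).+2)%:R : 'Z_(p ^ m.+1)) = a%:R.
Proof. by apply: val_inj; rewrite !Zp_nat /= modn_dvdm. Qed.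

Lemma padic_natP (n m : nat) :
  (((n%:R : 'Z_(p ^ m.+2)) : nat)%:R : 'Z_(p ^ m.+1)) = n%:R.
Proof. by rewrite (Zp_nat (Zp_trunc (p ^ m.+2))); exact: red. Qed.

Lemma padic_addP x y m :
  (((padic_seq x m.+1 + padic_seq y m.+1)%R : nat)%:R : 'Z_(p ^ m.+1))
  = padic_seq x m + padic_seq y m.
Proof.
by rewrite -(padic_seqP x m) -(padic_seqP y m) -natrD; exact: red.
Qed.

Lemma padic_mulP x y m :
  (((padic_seq x m.+1 * padic_seq y m.+1)%R : nat)%:R : 'Z_(p ^ m.+1))
  = padic_seq x m * padic_seq y m.
Proof.
by rewrite -(padic_seqP x m) -(padic_seqP y m) -natrM; exact: red.
Qed.

Lemma padic_oppP x m :
  (((- padic_seq x m.+1)%R : nat)%:R : 'Z_(p ^ m.+1)) = - padic_seq x m.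
Proof.
apply/eqP; rewrite -addr_eq0 -(padic_seqP x m) -natrD -red.
rewrite -[X in X%:R]/(nat_of_ord (- padic_seq x m.+1 + padic_seq x m.+1)).
by rewrite addNr.
Qed.

Definition padic_zero : padic p := Padic (padic_natP 0).
Definition padic_one : padic p := Padic (padic_natP 1).
Definition padic_add x y : padic p := Padic (padic_addP x y).
Definition padic_opp x : padic p := Padic (padic_oppP x).
Definition padic_mul x y : padic p := Padic (padic_mulP x y).

Let addA : associative padic_add.
Proof. by move=> x y z; apply: padicP => m; exact: addrA. Qed.
Let addC : commutative padic_add.
Proof. by move=> x y; apply: padicP => m; exact: addrC. Qed.
Let add0 : left_id padic_zero padic_add.
Proof. by move=> x; apply: padicP => m; exact: add0r. Qed.
Let addN : left_inverse padic_zero padic_opp padic_add.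
Proof. by move=> x; apply: padicP => m; exact: addNr. Qed.
HB.instance Definition _ := GRing.isZmodule.Build (padic p) addA addC add0 addN.

Let mulA : associative padic_mul.
Proof. by move=> x y z; apply: padicP => m; exact: mulrA. Qed.
Let mulC : commutative padic_mul.
Proof. by move=> x y; apply: padicP => m; exact: mulrC. Qed.
Let mul1 : left_id padic_one padic_mul.
Proof. by move=> x; apply: padicP => m; exact: mul1r. Qed.
Let mulD : left_distributive padic_mul padic_add.
Proof. by move=> x y z; apply: padicP => m; exact: mulrDl. Qed.
Let one_neq0 : padic_one != 0.
Proof.
by apply/eqP => /(congr1 (@padic_res p 0)) /eqP; apply/negP; exact: oner_neq0.
Qed.
HB.instance Definition _ :=
  GRing.Zmodule_isComNzRing.Build (padic p) mulA mulC mul1 mulD one_neq0.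

End PadicRing.

Section PadicRes.
Variables p m : nat.

Let res_zmod_morphism : zmod_morphism (@padic_res p m).
Proof. by []. Qed.
HB.instance Definition _ := GRing.isZmodMorphism.Build
  (padic p) ('Z_(p ^ m.+1)) (@padic_res p m) res_zmod_morphism.

Let res_monoid_morphism : monoid_morphism (@padic_res p m).
Proof. by []. Qed.
HB.instance Definition _ := GRing.isMonoidMorphism.Build
  (padic p) ('Z_(p ^ m.+1)) (@padic_res p m) res_monoid_morphism.

End PadicRes.

(* The residue classes mod p^(m+1) form a countable base of the p-adic
   topology, so the sigma-algebra they generate is the Borel one. *)
Definition padic_balls (p : nat) : set (set (padic p)) :=
  [set B | exists m (r : 'Z_(p ^ m.+1)), B = [set x | padic_res m x = r]].
Arguments padic_balls : clear implicits.

HB.instance Definition _ (p : nat) := isPointed.Build (padic p) 0.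
HB.instance Definition _ (p : nat) :=
  Measurable.copy (padic p) (g_sigma_algebraType (padic_balls p)).

Section Cokernel.
Variables (A : comNzRingType) (m n : nat) (M : 'M[A]_(m, n)).

Definition col_image : {pred 'cV[A]_m} :=
  fun w => `[< exists v : 'cV[A]_n, w = M *m v >].

Lemma col_image_zmod_closed : zmod_closed col_image.
Proof.
split; first by apply/asboolP; exists 0; rewrite mulmx0.
move=> _ _ /asboolP[u ->] /asboolP[v ->]; apply/asboolP.
by exists (u - v); rewrite mulmxBr.
Qed.
HB.instance Definition _ :=
  GRing.isZmodClosed.Build 'cV[A]_m col_image col_image_zmod_closed.

Definition cok : zmodType := Quotient.quot col_image.

End Cokernel.

Definition zmod_isog (U V : zmodType) : Prop :=
  exists f : {additive U -> V}, bijective f.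

Section RandomMatrices.
Context {d : measure_display} {T : measurableType d} {R : realType}.
Variable P : probability T R.

Definition mutually_independent {d'} {S : measurableType d'} {I : finType}
    (D : {set I}) (X : I -> T -> S) : Prop :=
  forall (J : {set I}) (B : I -> set S), J \subset D ->
    (forall i, i \in J -> measurable (B i)) ->
    P (\bigcap_(i in [set` J]) (X i @^-1` B i)) =
      (\prod_(i in J) P (X i @^-1` B i))%E.

Definition eps_balanced (p : nat) (eps : R) (xi : T -> padic p) : Prop :=
  forall r : 'Z_p,
    (P [set t | (padic_res 0 (xi t) : 'Z_p) = r] <= (1 - eps)%:E)%E.

(* 0-based form of: i <= alpha l and j <= beta l for some l. *)
Definition in_stairs {k : nat} (alpha beta : 'I_k -> nat) (i j : nat) : bool :=
  [exists l : 'I_k, (i < alpha l)%N && (j < beta l)%N].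

Definition eps_balanced_stairs_matrix {p n k : nat} (eps : R)
    (alpha beta : 'I_k -> nat) (M : T -> 'M[padic p]_n) : Prop :=
  [/\ forall t (i j : 'I_n), in_stairs alpha beta i j -> M t i j = 0,
      forall i j : 'I_n, ~~ in_stairs alpha beta i j ->
        measurable_fun setT (fun t => M t i j) /\
        eps_balanced eps (fun t => M t i j)
    & mutually_independent
        [set ij : 'I_n * 'I_n | ~~ in_stairs alpha beta ij.1 ij.2]%SET
        (fun ij t => M t ij.1 ij.2)].

End RandomMatrices.

(* Satisfiable only when k <= n; the step of index l : 'I_k is the (l+1)-th. *)
Definition stair_indices {k : nat} (n : nat) (alpha beta : 'I_k -> nat) : Prop :=
  [/\ forall l, (1 <= alpha l <= n)%N,
      forall l l' : 'I_k, (l < l')%N -> (alpha l' < alpha l)%N,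
      forall l, (1 <= beta l <= n)%N
    & forall l l' : 'I_k, (l < l')%N -> (beta l < beta l')%N].

(* Main.v *)
(* If [p ^ m] kills [G], being isomorphic to [G] can be tested modulo [p ^ m.+1],
   so everything reduces to finite sums. Fix [t] and split an n x n matrix as
   [row_mx B C], where [C] consists of the last [t] columns; these have no forced
   zeros once [n] is large. Write [rho = 1 - eps].

   By Odlyzko's bound a column falls into the span modulo [p] of the preceding
   ones with probability at most [rho ^ c], where [c] is the number of free
   entries of the column minus the number of preceding columns. Along each step
   of the staircase these exponents decrease by one at a time and stay above
   [n - alpha - beta], so [B] has full column rank modulo [p] up to probability
   [O(rho ^ t) + o(1)]. Then the span of [B] is a direct summand with free
   quotient of rank [t], and the cokernel of the whole matrix is that of [N *m C],
   where [N] is the projection onto the quotient.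

   A nonzero functional modulo [p] with few nonzero coordinates annihilates [B]
   with probability tending to 0. If none does, every nonzero combination of the
   rows of [N] modulo [p] has many nonzero entries, and each column of [N *m C]
   is nearly uniform on [(Z/p^(m+1))^t]: the squared L2 norm of its law drops,
   whenever an entry is revealed, by an amount that controls the failure of
   invariance under translation by the corresponding column of [N].

   Hence the cokernel is close in law to that of a uniform t x t matrix, for which
   the probability of being isomorphic to [G] is computed exactly up to the
   proportion of generating t-tuples of [G]: it is
   [#Sur / (#|G| ^ t * #|Aut G|) * prod_(i <= t) (1 - p ^- i)]. Letting [n], and
   then [t], tend to infinity gives the theorem. *)

Require Import Defs.
From HB Require Import structures.
From mathcomp Require Import all_boot all_order all_algebra all_fingroup all_solvable.
From mathcomp Require Import all_classical all_reals all_analysis.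
From mathcomp Require Import ring lra zify.

Set Implicit Arguments.
Unset Strict Implicit.
Unset Printing Implicit Defensive.

Import Order.TTheory GRing.Theory Num.Theory.
Import numFieldNormedType.Exports.

Local Open Scope ring_scope.

(** * Expectation over matrices with independent entries *)

Section Expectation.
Variables (R : realFieldType) (A : finZmodType).

Definition is_pmf (m : A -> R) : Prop := (forall a, 0 <= m a) /\ \sum_a m a = 1.

Definition mx_weight (r c : nat) (mu : 'I_r -> 'I_c -> A -> R) (X : 'M[A]_(r, c)) : R :=
  \prod_j \prod_i mu i j (X i j).

Definition expect (r c : nat) (mu : 'I_r -> 'I_c -> A -> R) (f : 'M[A]_(r, c) -> R) : R :=
  \sum_X mx_weight mu X * f X.

Lemma expect_ext r c (mu : 'I_r -> 'I_c -> A -> R) f g :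
  f =1 g -> expect mu f = expect mu g.
Proof. by move=> fg; apply: eq_bigr => X _; rewrite fg. Qed.

(** A matrix with an entry outside the support of its law has weight 0. *)
Lemma expect_eq_supp r c (mu : 'I_r -> 'I_c -> A -> R) (f g : 'M[A]_(r, c) -> R) :
  (forall X : 'M[A]_(r, c), (forall i j, mu i j (X i j) != 0) -> f X = g X) ->
  expect mu f = expect mu g.
Proof.
move=> fg; apply: eq_bigr => X _.
have [->|w0] := eqVneq (mx_weight mu X) 0; first by rewrite !mul0r.
rewrite fg // => i j; apply: contra_neq w0 => mu0.
by rewrite /mx_weight (bigD1 j) //= (bigD1 i) //= mu0 !mul0r.
Qed.

Lemma expectD r c (mu : 'I_r -> 'I_c -> A -> R) f g :
  expect mu (fun X => f X + g X) = expect mu f + expect mu g.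
Proof. by rewrite -big_split; apply: eq_bigr => X _; rewrite /= mulrDr. Qed.

Lemma expect_sum r c (mu : 'I_r -> 'I_c -> A -> R) (I : finType) (Q : pred I) f :
  expect mu (fun X => \sum_(i | Q i) f i X) = \sum_(i | Q i) expect mu (f i).
Proof. by rewrite exchange_big; apply: eq_bigr => X _; rewrite /= mulr_sumr. Qed.

Lemma expectZ r c (mu : 'I_r -> 'I_c -> A -> R) a f :
  expect mu (fun X => a * f X) = a * expect mu f.
Proof. by rewrite mulr_sumr; apply: eq_bigr => X _; rewrite /= mulrCA. Qed.

Lemma expect_row r c1 c2 (mu : 'I_r -> 'I_(c1 + c2) -> A -> R) f :
  expect mu f = expect (fun i j => mu i (lshift c2 j))
    (fun B => expect (fun i j => mu i (rshift c1 j)) (fun C => f (row_mx B C))).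
Proof.
rewrite /expect (reindex (uncurry (@row_mx A r c1 c2))) /=;
  last first.
  exists (fun X => (lsubmx X, rsubmx X)) => [[B C] _|X _] /=.
    by rewrite row_mxKl row_mxKr.
  by rewrite hsubmxK.
under [RHS]eq_bigr => B _ do rewrite mulr_sumr.
rewrite pair_bigA /=; apply: eq_bigr => -[B C] _ /=.
rewrite mulrA; congr (_ * _); rewrite /mx_weight big_split_ord /=.
by congr (_ * _); apply: eq_bigr => j _; apply: eq_bigr => i _;
  rewrite ?row_mxEl ?row_mxEr.
Qed.

Lemma expect_col r1 r2 c (mu : 'I_(r1 + r2) -> 'I_c -> A -> R) f :
  expect mu f = expect (fun i j => mu (lshift r2 i) j)
    (fun B => expect (fun i j => mu (rshift r1 i) j) (fun C => f (col_mx B C))).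
Proof.
rewrite /expect (reindex (uncurry (@col_mx A r1 r2 c))) /=;
  last first.
  exists (fun X => (usubmx X, dsubmx X)) => [[B C] _|X _] /=.
    by rewrite col_mxKu col_mxKd.
  by rewrite vsubmxK.
under [RHS]eq_bigr => B _ do rewrite mulr_sumr.
rewrite pair_bigA /=; apply: eq_bigr => -[B C] _ /=.
rewrite mulrA; congr (_ * _); rewrite /mx_weight -big_split; apply: eq_bigr => j _.
rewrite big_split_ord /=.
by congr (_ * _); apply: eq_bigr => i _; rewrite ?col_mxEu ?col_mxEd.
Qed.

Lemma expect11 (mu : 'I_1 -> 'I_1 -> A -> R) f :
  expect mu f = \sum_a mu 0 0 a * f (const_mx a).
Proof.
rewrite /expect (reindex (fun a => const_mx a : 'M[A]_1)) /=; last first.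
  exists (fun X : 'M[A]_1 => X 0 0) => [a _|X _]; first by rewrite mxE.
  by apply/matrixP => i j; rewrite !ord1 mxE.
by apply: eq_bigr => a _; rewrite /mx_weight !big_ord1 mxE.
Qed.

Lemma expect_r0 c (mu : 'I_0 -> 'I_c -> A -> R) (f : 'M[A]_(0, c) -> R) :
  expect mu f = f 0.
Proof.
rewrite /expect (bigD1 0) //= big1 ?addr0 => [|Y]; last first.
  by case/eqP; apply/matrixP => -[].
by rewrite /mx_weight big1 ?mul1r // => j _; rewrite big_ord0.
Qed.

Lemma expect_c0 r (mu : 'I_r -> 'I_0 -> A -> R) (f : 'M[A]_(r, 0) -> R) :
  expect mu f = f 0.
Proof.
rewrite /expect (bigD1 0) //= big1 ?addr0 => [|Y]; last first.
  by case/eqP; apply/matrixP => ? -[].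
by rewrite /mx_weight big_ord0 mul1r.
Qed.

Lemma expect1_col r (mu : 'I_r -> 'I_1 -> A -> R) :
  (forall i, is_pmf (mu i 0)) -> expect mu (fun=> 1) = 1.
Proof.
elim: r mu => [|r IH] mu pmf; first by rewrite expect_r0.
rewrite (@expect_col 1 r) (expect_ext _ (g := fun=> 1)); last first.
  by move=> B; apply: IH => i; exact: pmf.
rewrite expect11 -[RHS](pmf ord0).2; apply: eq_bigr => a _; rewrite mulr1.
by congr (mu _ _ a); apply: val_inj.
Qed.

(** Columns are independent; the induction splits off the first one. *)
Lemma expect_prod_col r c (mu : 'I_r -> 'I_c -> A -> R) (f : 'I_c -> 'cV[A]_r -> R) :
  expect mu (fun X => \prod_j f j (col j X)) =
  \prod_j expect (fun i (_ : 'I_1) => mu i j) (f j).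
Proof.
elim: c mu f => [|c IH] mu f.
  by rewrite expect_c0 !big_ord0.
rewrite (@expect_row r 1 c) big_ord_recl.
have shE (j : 'I_c) : rshift 1 j = lift ord0 j by apply: val_inj.
rewrite -[X in _ = _ * X]IH mulrC -expectZ.
have -> : (fun i (j : 'I_1) => mu i (lshift c j)) = fun i _ => mu i ord0.
  by apply/funext => i; apply/funext => j; congr mu; apply: val_inj; rewrite ord1.
have -> : (fun i j => mu i (rshift 1 j)) = fun i j => mu i (lift ord0 j).
  by apply/funext => i; apply/funext => j; rewrite shE.
apply: expect_ext => B; rewrite mulrC -expectZ; apply: expect_ext => C.
rewrite big_ord_recl /=; congr (_ * _).
  congr (f _ _); apply/matrixP => i j; rewrite !mxE ord1.
  by case: splitP => // j' _; rewrite ord1.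
apply: eq_bigr => j _; congr (f _ _); apply/matrixP => i j'.
by rewrite -shE !mxE; case: splitP => [k /= kE|k [/val_inj ->]] //; case: k kE => -[].
Qed.

Lemma expect1 r c (mu : 'I_r -> 'I_c -> A -> R) :
  (forall i j, is_pmf (mu i j)) -> expect mu (fun=> 1) = 1.
Proof.
move=> pmf; rewrite (expect_ext _ (g := fun X => \prod_(j < c) 1)).
  by rewrite (expect_prod_col mu (fun _ _ => 1)) big1 // => j _; exact: expect1_col.
by move=> X; rewrite big1.
Qed.

Lemma expect_le r c (mu : 'I_r -> 'I_c -> A -> R) f g :
  (forall i j, is_pmf (mu i j)) -> (forall X, f X <= g X) -> expect mu f <= expect mu g.
Proof.
move=> pmf fg; apply: ler_sum => X _; apply: ler_wpM2l => //.
by apply: prodr_ge0 => j _; apply: prodr_ge0 => i _; exact: (pmf i j).1.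
Qed.

Lemma expect_cst r c (mu : 'I_r -> 'I_c -> A -> R) a :
  (forall i j, is_pmf (mu i j)) -> expect mu (fun=> a) = a.
Proof.
move=> pmf; rewrite -[RHS]mulr1 -(expect1 pmf) -expectZ.
by apply: expect_ext => X; rewrite mulr1.
Qed.

Lemma expectB r c (mu : 'I_r -> 'I_c -> A -> R) f g :
  expect mu (fun X => f X - g X) = expect mu f - expect mu g.
Proof. by rewrite -sumrB; apply: eq_bigr => X _; rewrite mulrBr. Qed.

Lemma expect_norm_le r c (mu : 'I_r -> 'I_c -> A -> R) f :
  (forall i j, is_pmf (mu i j)) -> `|expect mu f| <= expect mu (fun X => `|f X|).
Proof.
move=> pmf; apply: le_trans (ler_norm_sum _ _ _) _; apply: ler_sum => X _.
rewrite normrM ger0_norm //.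
by apply: prodr_ge0 => j _; apply: prodr_ge0 => i _; exact: (pmf i j).1.
Qed.

End Expectation.
(** * Equidistribution of random combinations *)

Section Equidistribution.
Variables (R : realFieldType) (A : finComUnitRingType) (t : nat).
Implicit Types (f : 'cV[A]_t -> R) (g h y : 'cV[A]_t) (m : A -> R).

Definition energy f : R := \sum_y f y ^+ 2.

Definition dirichlet f h : R := \sum_y (f (y + h) - f y) ^+ 2.

(** The law of [y + a *: g] for independent [y] of law [f] and [a] of law [m]. *)
Definition convolve m g f y : R := \sum_a m a * f (y - a *: g).

Lemma sum_shift f h : \sum_y f (y + h) = \sum_y f y.
Proof.
rewrite [RHS](reindex (fun y => y + h)) //.
by exists (fun y => y - h) => y _; rewrite ?addrK ?subrK.
Qed.

Lemma dirichlet_ge0 f h : 0 <= dirichlet f h.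
Proof. by apply: sumr_ge0 => y _; exact: sqr_ge0. Qed.

Lemma dirichlet0 f : dirichlet f 0 = 0.
Proof. by apply: big1 => y _; rewrite addr0 subrr expr0n. Qed.

(** Translate by [h], then by [g], and use [(a + b) ^ 2 <= 2 a ^ 2 + 2 b ^ 2]. *)
Lemma dirichletD f g h :
  dirichlet f (g + h) <= 2 * dirichlet f g + 2 * dirichlet f h.
Proof.
rewrite -[dirichlet f g](sum_shift (fun y => (f (y + g) - f y) ^+ 2) h).
rewrite !mulr_sumr -big_split; apply: ler_sum => y _ /=.
rewrite (addrC g) addrA; set u := f _; set v := f (y + h); set w := f y.
have := sqr_ge0 (u - v - (v - w)); nra.
Qed.

Lemma dirichletMn f h k : dirichlet f (h *+ k) <= 4 ^+ k * dirichlet f h.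
Proof.
have D0 := dirichlet_ge0 f h.
elim: k => [|k IH]; first by rewrite mulr0n dirichlet0 mul1r.
rewrite mulrSr exprS; apply: le_trans (dirichletD _ _ _) _.
have : 1 <= 4 ^+ k :> R by rewrite exprn_ege1 // ler1n.
by move: IH; set e := 4 ^+ k; nra.
Qed.

Lemma dirichlet_sum f (I : Type) (s : seq I) (h : I -> 'cV[A]_t) (b : R) :
  0 <= b -> (forall i, dirichlet f (h i) <= b) ->
  dirichlet f (\sum_(i <- s) h i) <= 4 ^+ size s * b.
Proof.
move=> b0 hb; elim: s => [|i s IH] /=; first by rewrite big_nil dirichlet0 mul1r.
rewrite big_cons exprS; apply: le_trans (dirichletD _ _ _) _.
have : 1 <= 4 ^+ size s :> R by rewrite exprn_ege1 // ler1n.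
by move: IH (hb i); set e := 4 ^+ _; nra.
Qed.

(** Translation commutes with convolution, and averaging over [m] cannot increase an L2 norm. *)
Lemma dirichlet_convolve m g f h :
  is_pmf m -> dirichlet (convolve m g f) h <= dirichlet f h.
Proof.
move=> [m0 m1]; pose G y := (f (y + h) - f y) ^+ 2.
apply: (@le_trans _ _ (\sum_y \sum_a m a * G (y - a *: g))); last first.
  rewrite exchange_big /= -[leRHS]mul1r -m1 mulr_suml; apply: ler_sum => a _.
  by rewrite -mulr_sumr (sum_shift G).
apply: ler_sum => y _; rewrite /convolve -sumrB.
under eq_bigr => a _ do rewrite -mulrBr addrAC.
set F := fun a => f (y - a *: g + h) - f (y - a *: g).
(* Jensen: the variance of [F] under [m] is nonnegative. *)
have varE c : \sum_a m a * (F a - c) ^+ 2 =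
    \sum_a m a * F a ^+ 2 - 2 * c * (\sum_a m a * F a) + c ^+ 2 * \sum_a m a.
  by rewrite !mulr_sumr -sumrB -big_split; apply: eq_bigr => a _ /=; ring.
set c := \sum_a _; have : 0 <= \sum_a m a * (F a - c) ^+ 2.
  by apply: sumr_ge0 => a _; rewrite mulr_ge0 // sqr_ge0.
rewrite varE m1 -/c => cge.
by apply: (@le_trans _ _ (\sum_a m a * F a ^+ 2)) => //; move: cge; nra.
Qed.

(** Expanding the square of the average gives inner products of two translates of [f]; each is
    [energy f] minus half a Dirichlet term. *)
Lemma energy_convolve m g f : is_pmf m ->
  2 * (energy f - energy (convolve m g f)) =
  \sum_a \sum_b m a * m b * dirichlet f ((a - b) *: g).
Proof.
move=> [m0 m1].
have DE a b : dirichlet f ((a - b) *: g) =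
    2 * energy f - 2 * \sum_y f (y - a *: g) * f (y - b *: g).
  rewrite /dirichlet -(sum_shift _ (- (a *: g))).
  under eq_bigr => y _ do rewrite scalerBl addrA subrK.
  have s2 c : \sum_y f (y - c *: g) ^+ 2 = energy f.
    exact: (sum_shift (fun y => f y ^+ 2)).
  rewrite [2 * energy f]mulr_natl mulr2n -{1}(s2 a) -(s2 b).
  by rewrite !mulr_sumr -!big_split -sumrB; apply: eq_bigr => y _ /=; ring.
have -> : energy (convolve m g f) =
    \sum_a \sum_b m a * m b * \sum_y f (y - a *: g) * f (y - b *: g).
  rewrite /energy /convolve.
  under eq_bigr => y _ do rewrite expr2 mulr_suml.
  rewrite exchange_big; apply: eq_bigr => a _ /=.
  under eq_bigr => y _ do rewrite mulr_sumr.
  rewrite exchange_big; apply: eq_bigr => b _ /=.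
  by rewrite mulr_sumr; apply: eq_bigr => y _; ring.
under [RHS]eq_bigr => a _ do under eq_bigr => b _ do rewrite DE.
have e1 : energy f = \sum_a \sum_b m a * m b * energy f.
  under eq_bigr => a _ do rewrite -mulr_suml -mulr_sumr m1 mulr1.
  by rewrite -mulr_suml m1 mul1r.
rewrite {1}e1 -sumrB mulr_sumr; apply: eq_bigr => a _.
rewrite -sumrB mulr_sumr; apply: eq_bigr => b _; ring.
Qed.

(* Balancedness only controls residues modulo the maximal ideal, so the lemmas
   below fail for rings such as F_4, where 0-1 entries never leave F_2: every
   element of [A] has to be a multiple of 1. *)
Hypothesis natA : forall a : A, exists2 k, (k <= #|A|)%N & a = k%:R.

Lemma dirichlet_scale f (a : A) h :
  dirichlet f (a *: h) <= 4 ^+ #|A| * dirichlet f h.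
Proof.
have [k kA ->] := natA a; rewrite scaler_nat.
apply: le_trans (dirichletMn _ _ _) _; apply: ler_wpM2r; first exact: dirichlet_ge0.
by rewrite ler_eXn2l // ltr1n.
Qed.

Variables (F : finFieldType) (pi : {rmorphism A -> F}) (rho : R).
Hypothesis pi_unit : forall a, pi a != 0 -> a \is a GRing.unit.
Hypothesis rho01 : 0 < rho < 1.

Definition balanced m : Prop := forall r : F, \sum_(a | pi a == r) m a <= rho.

(** Two independent samples [a], [b] of [m] differ under [pi] with probability at least [1 - rho].
    Then [a - b] is a unit, so [g] is a multiple of [(a - b) *: g], and [dirichlet_scale] bounds the
    corresponding terms of [energy_convolve] from below. *)
Lemma energy_drop m g f : is_pmf m -> balanced m ->
  (1 - rho) / 4 ^+ #|A| * dirichlet f g <= 2 * (energy f - energy (convolve m g f)).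
Proof.
move=> pm bm; rewrite energy_convolve //; case: pm => m0 m1.
set K := 4 ^+ _; have K0 : 0 < K by rewrite exprn_gt0.
have D0 := dirichlet_ge0 f.
apply: (@le_trans _ _ (\sum_a \sum_(b | pi b != pi a) m a * m b * (dirichlet f g / K))).
  under eq_bigr => a _.
    rewrite -mulr_suml -mulr_sumr.
    rewrite (_ : \sum_(b | _) _ = 1 - \sum_(b | pi b == pi a) m b); last first.
      by rewrite -m1 [in RHS](bigID (fun b => pi b == pi a)) /= addrC addrK.
    over.
  rewrite -mulr_suml mulrAC -mulrA; apply: ler_wpM2r.
    by rewrite mulr_ge0 ?invr_ge0 // ltW.
  rewrite -[leLHS]mul1r -m1 mulr_suml; apply: ler_sum => a _.
  by apply: ler_wpM2l => //; rewrite lerB.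
apply: ler_sum => a _; rewrite [leRHS](bigID (fun b => pi b == pi a)) /=.
rewrite -[leLHS]add0r; apply: lerD.
  by apply: sumr_ge0 => b _; rewrite !mulr_ge0.
apply: ler_sum => b ab; apply: ler_wpM2l; first by rewrite mulr_ge0.
rewrite ler_pdivrMr // mulrC.
have u : a - b \is a GRing.unit by rewrite pi_unit // rmorphB subr_eq0 eq_sym.
by rewrite -{1}[g]scale1r -(mulVr u) -scalerA dirichlet_scale.
Qed.

Definition law n (nu : 'I_n -> A -> R) (N : 'M[A]_(t, n)) y : R :=
  expect (fun i (_ : 'I_1) => nu i) (fun x => (N *m x == y)%:R).

Lemma law_recl n (nu : 'I_n.+1 -> A -> R) (N : 'M[A]_(t, 1 + n)) :
  law nu N =1 convolve (nu ord0) (lsubmx N)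
    (law (fun i => nu (lift ord0 i)) (rsubmx N)).
Proof.
move=> y; rewrite /law (@expect_col _ _ 1 n) expect11; apply: eq_bigr => a _.
congr (_ * _); first by congr (nu _ _); apply: val_inj.
have -> : (fun i (_ : 'I_1) => nu (rshift 1 i)) = fun i _ => nu (lift ord0 i).
  by apply/funext => i; apply/funext => _; congr nu; apply: val_inj.
apply: expect_ext => x.
have -> : N *m col_mx (const_mx a) x = lsubmx N *m const_mx a + rsubmx N *m x.
  by rewrite -mul_row_col hsubmxK.
congr (nat_of_bool _)%:R; rewrite [RHS]eq_sym subr_eq [RHS]eq_sym [in RHS]addrC.
congr (_ + _ == _).
by apply/matrixP => i j; rewrite !mxE big_ord1 !mxE mulrC (ord1 j).
Qed.

Lemma energy_ext f1 f2 : f1 =1 f2 -> energy f1 = energy f2.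
Proof. by move=> e; apply: eq_bigr => y _; rewrite e. Qed.

Lemma dirichlet_ext f1 f2 h : f1 =1 f2 -> dirichlet f1 h = dirichlet f2 h.
Proof. by move=> e; apply: eq_bigr => y _; rewrite !e. Qed.

(* Every entry revealed costs energy in proportion to how far the law is from
   being invariant under translation by the corresponding column. *)
Lemma sum_dirichlet_law n (nu : 'I_n -> A -> R) (N : 'M[A]_(t, n)) :
  (forall i, is_pmf (nu i)) -> (forall i, balanced (nu i)) ->
  (1 - rho) / 4 ^+ #|A| * \sum_i dirichlet (law nu N) (col i N) <=
  2 * (1 - energy (law nu N)).
Proof.
set c := (1 - rho) / _.
have c0 : 0 <= c.
  by rewrite divr_ge0 ?exprn_ge0 // subr_ge0 ltW //; case/andP: rho01.
elim: n nu N => [|n IH] nu N pm bm.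
  rewrite big_ord0 mulr0 /energy (bigD1 0) //= big1 => [|y y0].
    by rewrite /law expect_r0 mulmx0 eqxx expr1n addr0 subrr mulr0.
  by rewrite /law expect_r0 mulmx0 eq_sym (negPf y0) expr0n.
have e := @law_recl n nu N; rewrite (energy_ext e) big_ord_recl mulrDr.
move: (IH _ (rsubmx (N : 'M[A]_(t, 1 + n))) (fun i => pm (lift ord0 i))
  (fun i => bm (lift ord0 i))).
set f := law _ (rsubmx _) => {}IH.
have := energy_drop (lsubmx (N : 'M[A]_(t, 1 + n))) f (pm ord0) (bm ord0).
rewrite -/c => drop.
have h0 : c * dirichlet (law nu N) (col ord0 N) <= c * dirichlet f (lsubmx (N : 'M[A]_(t, 1 + n))).
  apply: ler_wpM2l => //; rewrite (dirichlet_ext _ e).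
  rewrite (_ : col ord0 N = lsubmx (N : 'M[A]_(t, 1 + n))) ?dirichlet_convolve //.
  by apply/colP => i; rewrite !mxE; congr (N i _); apply: val_inj.
have hS : c * \sum_(i < n) dirichlet (law nu N) (col (lift ord0 i) N) <=
    c * \sum_i dirichlet f (col i (rsubmx (N : 'M[A]_(t, 1 + n)))).
  apply: ler_wpM2l => //; apply: ler_sum => i _; rewrite (dirichlet_ext _ e).
  rewrite (_ : col (lift ord0 i) N = col i (rsubmx (N : 'M[A]_(t, 1 + n)))).
    exact: dirichlet_convolve.
  by apply/colP => j; rewrite !mxE; congr (N j _); apply: val_inj.
by move: IH drop h0 hS; lra.
Qed.

End Equidistribution.

(** * Near-uniformity of the law of [N *m x] *)

Section NearUniform.
Variables (R : realFieldType) (A : finComUnitRingType).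
Hypothesis natA : forall a : A, exists2 k, (k <= #|A|)%N & a = k%:R.
Variables (F : finFieldType) (pi : {rmorphism A -> F}) (rho : R).
Hypothesis pi_unit : forall a, pi a != 0 -> a \is a GRing.unit.
Hypothesis rho01 : 0 < rho < 1.

Lemma unitmx_of_residue n (X : 'M[A]_n) : map_mx pi X \in unitmx -> X \in unitmx.
Proof.
rewrite !unitmxE det_map_mx => u; apply: pi_unit.
by apply: contraL u => /eqP ->; rewrite unitr0.
Qed.

(** Zeroing the columns outside [S] leaves a matrix of full row rank, so [t] of its columns form an
    invertible matrix. A zero column would make the determinant vanish, so all of them lie in
    [S]. *)
Lemma independent_cols (t n : nat) (N : 'M[F]_(t, n)) (S : {set 'I_n}) :
  (forall u : 'rV[F]_t, u != 0 -> exists2 i, i \in S & (u *m N) 0 i != 0) ->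
  exists2 s : 'I_t -> 'I_n, forall k, s k \in S & colsub s N \in unitmx.
Proof.
move=> uN; pose NS := \matrix_(i, j) (if j \in S then N i j else 0).
have freeNS : row_full NS^T.
  rewrite /row_full mxrank_tr -/(row_free NS) -kermx_eq0; apply/rowV0P => u.
  move=> /sub_kermxP uNS; apply/eqP/negPn/negP => /uN[i iS].
  move/matrixP/(_ 0 i): uNS; rewrite !mxE => e /eqP[]; rewrite -[RHS]e.
  by apply: eq_bigr => k _; rewrite !mxE iS.
pose s := fullrankfun freeNS.
have := fullrowsub_unit freeNS.
rewrite -/s -unitmx_tr trmx_mxsub trmxK => us.
have sS k : s k \in S.
  apply: contraLR us => skS; rewrite unitmxE unitfE negbK; apply/eqP.
  rewrite (expand_det_col _ k) big1 // => i _.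
  by rewrite !mxE (negPf skS) mul0r.
exists s => //; rewrite (_ : colsub s N = colsub s NS) //.
by apply/matrixP => i j; rewrite !mxE sS.
Qed.

Lemma sum_law t n (nu : 'I_n -> A -> R) (N : 'M[A]_(t, n)) :
  (forall i, is_pmf (nu i)) -> \sum_y law nu N y = 1.
Proof.
move=> pm; rewrite -expect_sum -[RHS](@expect1_col _ _ _ (fun i _ => nu i)) //.
apply: expect_ext => x; rewrite (bigD1 (N *m x)) //= eqxx big1 ?addr0 // => y.
by rewrite eq_sym => /negPf ->.
Qed.

(** The factors come from [dirichlet_sum] with [t] terms, from [dirichlet_scale], and from twice the
    bound that [sum_dirichlet_law] puts on the total of the Dirichlet terms. *)
Definition near_uniform_cst (t : nat) : R :=
  4 ^+ t * (4 ^+ #|A| * (4 * 4 ^+ #|A| / (1 - rho))).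

(** The Dirichlet terms of the columns of [N] have a total bounded independently of [n], so fewer
    than [w] of them are large. Every nonzero combination of the rows modulo [pi] meets at least [w]
    columns, hence the columns with a small term still generate [A ^ t], and the law is nearly
    invariant under all translations. *)
Lemma law_near_uniform t n (nu : 'I_n -> A -> R) (N : 'M[A]_(t, n)) (w : nat) y :
  (forall i, is_pmf (nu i)) -> (forall i, balanced pi rho (nu i)) -> (0 < w)%N ->
  (forall u : 'rV[F]_t, u != 0 ->
     (w <= #|[set i | (u *m map_mx pi N) ord0 i != 0%R]%SET|)%N) ->
  (law nu N y - (#|A| ^ t)%:R^-1) ^+ 2 <= near_uniform_cst t / w%:R.
Proof.
move=> pm bm w0 uN; have [rho0 rho1] := andP rho01; set f := law nu N.
set a4 : R := 4 ^+ #|A|; have a40 : 0 < a4 by rewrite exprn_gt0.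
have w0' : 0 < w%:R :> R by rewrite ltr0n.
pose C := 2 * a4 / (1 - rho).
have C0 : 0 < C by rewrite divr_gt0 ?subr_gt0 // mulr_gt0.
have D0 h : 0 <= dirichlet f h by exact: dirichlet_ge0.
have sumD : \sum_i dirichlet f (col i N) <= C.
  have := sum_dirichlet_law natA pi_unit rho01 N pm bm.
  rewrite -/f -/a4 => h.
  have : (1 - rho) / a4 * \sum_i dirichlet f (col i N) <= 2.
    apply: le_trans h _; rewrite ler_piMr // gerBl.
    by apply: sumr_ge0 => z _; rewrite sqr_ge0.
  by rewrite mulrC -ler_pdivlMr ?divr_gt0 ?subr_gt0 // invf_div mulrA.
(* The total is at most [C], so by Markov's inequality fewer than [w] columns exceed [2 * C / w]. *)
pose S := [set i | dirichlet f (col i N) <= 2 * C / w%:R]%SET.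
have ScE : (#|~: S| < w)%N.
  rewrite -(ltr_nat R) -(ltr_pM2r (_ : 0 < 2 * C / w%:R)); last first.
    by rewrite divr_gt0 // mulr_gt0.
  rewrite [ltRHS]mulrC divfK ?gt_eqF // (le_lt_trans (y := C)) //; last by lra.
  apply: le_trans sumD; rewrite [leRHS](bigID (mem S)) /= -[leLHS]add0r.
  apply: lerD; first exact: sumr_ge0.
  rewrite -sum1_card natr_sum mulr_suml.
  rewrite (eq_bigl (fun i => i \notin S)) => [|i]; last by rewrite inE.
  by apply: ler_sum => i; rewrite inE -ltNge mul1r => /ltW.
have [s sS us] : exists2 s : 'I_t -> 'I_n, forall k, s k \in S &
    colsub s (map_mx pi N) \in unitmx.
  apply: independent_cols => u /uN wu; apply/exists_inP; apply: contraT.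
  move=> /exists_inPn uS; move: wu; rewrite leqNgt => /negP[].
  apply: leq_ltn_trans ScE; apply/subset_leq_card/fintype.subsetP => i.
  by rewrite finset.in_set finset.in_setC; apply: contraL => /uS.
have {}us : colsub s N \in unitmx.
  by apply: unitmx_of_residue; rewrite map_mxsub.
have Dh h : dirichlet f h <= near_uniform_cst t / w%:R.
  rewrite -[h](mulKVmx us); set v := invmx _ *m h.
  have -> : colsub s N *m v = \sum_(k < t) v k 0 *: col (s k) N.
    apply/colP => i; rewrite !mxE summxE; apply: eq_bigr => k _.
    by rewrite !mxE mulrC.
  have -> : near_uniform_cst t / w%:R = 4 ^+ t * (a4 * (2 * C / w%:R)).
    by rewrite /near_uniform_cst /C -/a4; field; rewrite !gt_eqF // subr_gt0.
  have := @dirichlet_sum _ _ _ f _ (index_enum 'I_t)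
    (fun k => v k 0 *: col (s k) N) (a4 * (2 * C / w%:R)).
  rewrite -[index_enum _]enumT size_enum_ord; apply.
    apply: mulr_ge0; first exact: ltW.
    by apply: divr_ge0; [apply: mulr_ge0 => //; exact: ltW|exact: ler0n].
  move=> k; apply: le_trans (dirichlet_scale natA _ _ _) _.
  by apply: ler_wpM2l; [exact: ltW|have := sS k; rewrite inE].
(* The mean over [z] of [f y - f z] is [f y - 1 / #|A| ^ t]. *)
have cH : #|{: 'cV[A]_t}| = (#|A| ^ t)%N by rewrite card_mx muln1.
have A0 : (0 < #|A| ^ t)%N by rewrite expn_gt0; apply/orP; left; apply/card_gt0P; exists 0.
set q : R := (#|A| ^ t)%:R; have q0 : 0 < q by rewrite ltr0n.
set c := f y - q^-1.
have mean : \sum_z (f y - f z) = q * c.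
  rewrite sumrB sumr_const cH (sum_law _ pm) -mulr_natl -/q /c mulrBr divff //.
  by rewrite gt_eqF.
(* Nonnegativity of the variance bounds [q * c ^+ 2] by the sum of the [(f y - f z) ^+ 2]. *)
have : \sum_z (f y - f z - c) ^+ 2 = \sum_z (f y - f z) ^+ 2 - q * c ^+ 2.
  have -> : q * c ^+ 2 = 2 * c * (q * c) - q * c ^+ 2 by ring.
  rewrite -mean /q -cH -sum1_card natr_sum mulr_suml mulr_sumr -!sumrB.
  by apply: eq_bigr => z _; ring.
have : 0 <= \sum_z (f y - f z - c) ^+ 2 by apply: sumr_ge0 => z _; exact: sqr_ge0.
have : \sum_z (f y - f z) ^+ 2 <= q * (near_uniform_cst t / w%:R).
  rewrite /q -cH -sum1_card natr_sum mulr_suml; apply: ler_sum => z _.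
  rewrite mul1r; apply: le_trans (Dh (y - z)); rewrite /dirichlet (bigD1 z) //=.
  by rewrite [z + _]addrC subrK lerDl; apply: sumr_ge0 => *; exact: sqr_ge0.
move=> h1 h2 h3; rewrite -(ler_pM2l q0); lra.
Qed.

End NearUniform.
(** * Column rank modulo the maximal ideal *)

Section RankMod.
Variables (R : realFieldType) (A : finComUnitRingType) (F : finFieldType).
Variables (pi : {rmorphism A -> F}) (rho : R).
Hypothesis rho01 : 0 < rho < 1.

Lemma rho_exp_anti m n : (m <= n)%N -> rho ^+ n <= rho ^+ m.
Proof.
by move=> mn; case/andP: rho01 => r0 r1; apply: ler_wiXn2l => //; exact: ltW.
Qed.

(* The Odlyzko bound. The right-hand side [y] is arbitrary so that the
   induction can peel off the first entry of [x]. *)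
Lemma expect_mulmx_eq_le n c (nu : 'I_n -> A -> R) (C : 'M[F]_(n, c))
    (y : 'rV[F]_c) :
  (forall i, is_pmf (nu i)) -> (forall i, row i C != 0 -> balanced pi rho (nu i)) ->
  expect (fun i (_ : 'I_1) => nu i) (fun x => ((map_mx pi x)^T *m C == y)%:R)
    <= rho ^+ \rank C.
Proof.
have [rho0 rho1] := andP rho01.
elim: n nu C y => [|n IH] nu C y pm bm.
  rewrite expect_r0 (_ : \rank C = 0%N); first by rewrite expr0 lern1 leq_b1.
  by apply/eqP; rewrite -leqn0 rank_leq_row.
pose c1 := usubmx (C : 'M[F]_(1 + n, c)); pose C' := dsubmx (C : 'M[F]_(1 + n, c)).
have rC : \rank C = \rank (c1 + C')%MS.
  by rewrite addsmxE vsubmxK.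
pose P' z := expect (fun i (_ : 'I_1) => nu (lift ord0 i))
  (fun x => ((map_mx pi x)^T *m C' == z)%:R : R).
have P'le z : P' z <= rho ^+ \rank C'.
  apply: IH => [i|i Ci]; first exact: pm.
  apply: bm; apply: contra_neq Ci => /rowP Ci; apply/rowP => j.
  by have := Ci j; rewrite !mxE => <-; congr (C _ j); apply: val_inj.
have P'0 z : ~~ (z <= C')%MS -> P' z = 0.
  move=> zC; rewrite -[RHS](mul0r (expect (fun i (_ : 'I_1) => nu (lift ord0 i)) (fun=> 0))).
  rewrite -expectZ; apply: expect_ext => x; rewrite mul0r.
  by case: eqP => // xz; case/negP: zC; rewrite -xz submxMl.
have -> : expect (fun i (_ : 'I_1) => nu i) (fun x => ((map_mx pi x)^T *m C == y)%:R)
    = \sum_a nu ord0 a * P' (y - pi a *: c1).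
  rewrite (@expect_col _ _ 1 n) expect11; apply: eq_bigr => a _.
  congr (_ * _); first by congr (nu _ _); apply: val_inj.
  have -> : (fun i (_ : 'I_1) => nu (rshift 1 i)) = fun i _ => nu (lift ord0 i).
    by apply/funext => i; apply/funext => _; congr nu; apply: val_inj.
  apply: expect_ext => x.
  have -> : (map_mx pi (col_mx (const_mx a) x))^T *m (C : 'M[F]_(1 + n, c))
      = pi a *: c1 + (map_mx pi x)^T *m C'.
    transitivity ((map_mx pi (col_mx (const_mx a : 'M[A]_1) x))^T *m col_mx c1 C').
      by rewrite vsubmxK.
    rewrite map_col_mx tr_col_mx mul_row_col.
    congr (_ + _); apply/rowP => j; rewrite !mxE big_ord1 !mxE.
    by congr (_ * C _ _); apply: val_inj.
  congr (nat_of_bool _)%:R.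
  by rewrite [RHS]eq_sym subr_eq [RHS]eq_sym [in RHS]addrC.
have nu0 a : 0 <= nu ord0 a by case: (pm ord0) => + _; exact.
(* If [c1] lies in the row space of [C'], the rank does not grow, and the inductive bound is
   averaged over the first entry. *)
have [c1C|c1C] := boolP (c1 <= C')%MS.
  have -> : \rank C = \rank C' by rewrite rC (addsmx_idPr _).
  rewrite -[leRHS]mul1r -(pm ord0).2 mulr_suml; apply: ler_sum => a _.
  exact: ler_wpM2l.
have rCle : (\rank C <= (\rank C').+1)%N.
  rewrite rC; apply: leq_trans (mxrank_adds_leqif _ _) _.
  by rewrite -[leqRHS]add1n leq_add2r rank_leq_row.
apply: le_trans (rho_exp_anti rCle); rewrite exprS.
(* Otherwise the values [a] that bring [y - pi a *: c1] into the row space of [C'] all share one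
   residue, which gains the extra factor [rho]. *)
have [/existsP[a0 a0C]|/existsPn noC] := boolP [exists a, (y - pi a *: c1 <= C')%MS];
  last first.
  rewrite big1 ?mulr_ge0 ?exprn_ge0 ?(ltW rho0) // => a _.
  by rewrite P'0 ?mulr0.
apply: (@le_trans _ _ ((\sum_(a | pi a == pi a0) nu ord0 a) * rho ^+ \rank C')).
  rewrite (bigID (fun a => pi a == pi a0)) /= [X in _ + X]big1 ?addr0.
    by rewrite mulr_suml; apply: ler_sum => a _; exact: ler_wpM2l.
  move=> a aa0; rewrite P'0 ?mulr0 //; apply: contra c1C => aC.
  have : ((pi a - pi a0) *: c1 <= C')%MS.
    rewrite (_ : _ *: _ = (y - pi a0 *: c1) - (y - pi a *: c1)).
      by rewrite addmx_sub ?eqmx_opp.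
    by rewrite scalerBl opprB [RHS]addrC addrA subrK.
  by rewrite eqmx_scale ?subr_eq0.
rewrite ler_wpM2r ?exprn_ge0 ?(ltW rho0) //; apply: bm.
apply: contra c1C => /eqP C0; rewrite (_ : c1 = 0) ?sub0mx //.
apply/rowP => j; move/rowP/(_ j): C0; rewrite !mxE => <-.
by congr (C _ j); apply: val_inj.
Qed.

Definition partly_balanced n (fr : pred 'I_n) (nu : 'I_n -> A -> R) : Prop :=
  forall i, if fr i then balanced pi rho (nu i) else forall a, a != 0 -> nu i a = 0.

Definition row_mask n c (fr : pred 'I_n) (C : 'M[F]_(n, c)) : 'M[F]_(n, c) :=
  \matrix_(i, j) (if fr i then C i j else 0).

(** On the support of the laws the entries of [x] outside [fr] vanish, so masking the corresponding
    rows of [C] does not change the product. *)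
Lemma expect_mulmx_eq_le_mask n c fr (nu : 'I_n -> A -> R) (C : 'M[F]_(n, c))
    (y : 'rV[F]_c) :
  (forall i, is_pmf (nu i)) -> partly_balanced fr nu ->
  expect (fun i (_ : 'I_1) => nu i) (fun x => ((map_mx pi x)^T *m C == y)%:R)
    <= rho ^+ \rank (row_mask fr C).
Proof.
move=> pm pb; rewrite (@expect_eq_supp _ _ _ _ _ _
    (fun x => ((map_mx pi x)^T *m row_mask fr C == y)%:R)).
  apply: expect_mulmx_eq_le => // i; have := pb i; case: ifP => // fri _.
  by case/eqP; apply/rowP => j; rewrite !mxE fri.
move=> x nux; congr (_ == _)%:R; apply/rowP => j; rewrite !mxE.
apply: eq_bigr => i _; rewrite !mxE; have := pb i; case: ifP => // _ nu0.
have [->|/nu0 nux0] := eqVneq (x i 0) 0; first by rewrite rmorph0 !mul0r.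
by have := nux i 0; rewrite nux0 eqxx.
Qed.

(** The discarded part of [C] lies in a sum of spaces of rank at most 1, one for each masked row. *)
Lemma rank_row_mask n c (fr : pred 'I_n) (C : 'M[F]_(n, c)) :
  (\rank C <= \rank (row_mask fr C) + #|predC fr|)%N.
Proof.
have CE : C = row_mask fr C + row_mask (predC fr) C.
  by apply/matrixP => i j; rewrite !mxE /=; case: (fr i); rewrite ?addr0 ?add0r.
rewrite {1}CE; apply: leq_trans (mxrank_add _ _) _; rewrite leq_add2l.
have sC : (row_mask (predC fr) C <= \sum_(i in predC fr) <<row i C>>)%MS.
  apply/row_subP => i; have [fri|fri] := boolP (fr i).
    rewrite (_ : row _ _ = 0) ?sub0mx //.
    by apply/rowP => j; rewrite !mxE /= fri.
  apply: (sumsmx_sup i) => //; rewrite genmxE (_ : row _ _ = row i C) //.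
  by apply/rowP => j; rewrite !mxE /= fri.
apply: leq_trans (mxrankS sC) _; apply: leq_trans (mxrank_sum_leqif _) _ => /=.
rewrite -sum1_card; apply: leq_sum => i _; rewrite genmxE; exact: rank_leq_row.
Qed.

(** Membership in [W] means that the product with [cokermx W], of rank [n - \rank W], is zero; each
    masked row costs at most 1 of that rank. *)
Lemma expect_mem_span_le n c fr (nu : 'I_n -> A -> R) (W : 'M[F]_(c, n)) :
  (forall i, is_pmf (nu i)) -> partly_balanced fr nu ->
  expect (fun i (_ : 'I_1) => nu i) (fun x => ((map_mx pi x)^T <= W)%MS%:R)
    <= rho ^+ (n - #|predC fr| - \rank W).
Proof.
move=> pm pb; under expect_ext => x do rewrite submxE.
apply: le_trans (expect_mulmx_eq_le_mask _ _ pm pb) _; apply: rho_exp_anti.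
have := rank_row_mask fr (cokermx W); rewrite mxrank_coker; lia.
Qed.

Lemma rank_row_mx_lt n c (B : 'M[F]_(n, c)) (x : 'cV[F]_n) :
  (\rank (row_mx B x) < c + 1)%N -> ~~ (\rank B < c)%N -> (x^T <= B^T)%MS.
Proof.
rewrite -leqNgt => rBx rB.
have sB : (B^T <= B^T + x^T)%MS by exact: addsmxSl.
have := mxrank_leqif_sup sB; rewrite addsmxE -tr_row_mx !mxrank_tr => -[le1 eqE].
have /eqP : \rank B = \rank (row_mx B x) by apply/eqP; rewrite eqn_leq le1; lia.
rewrite eqE addsmx_sub => /andP[_].
by [].
Qed.

(** Union bound over the columns: the first dependence occurs at some column [j] lying in the span
    of its [j] independent predecessors. *)
Lemma expect_rank_lt n c (fr : 'I_n -> 'I_c -> bool) (mu : 'I_n -> 'I_c -> A -> R) :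
  (forall i j, is_pmf (mu i j)) ->
  (forall j, partly_balanced (fr^~ j) (mu^~ j)) ->
  expect mu (fun B => (\rank (map_mx pi B) < c)%N%:R)
    <= \sum_(j < c) rho ^+ (n - #|predC (fr^~ j)| - j).
Proof.
elim: c fr mu => [|c IH] fr mu pm pb; first by rewrite big_ord0 expect_c0.
move: fr mu pm pb; rewrite -[c.+1]addn1 => fr mu pm pb.
rewrite expect_row big_split_ord big_ord1 /= addn0.
set q := rho ^+ (n - _ - c).
have q0 : 0 <= q by apply: exprn_ge0; apply: ltW; case/andP: rho01.
have {}IH := IH (fun i j => fr i (lshift 1 j)) _ (fun i j => pm i (lshift 1 j))
  (fun j => pb (lshift 1 j)).
apply: le_trans (lerD IH (lexx q)).
rewrite -[q in leRHS](expect_cst q (fun i j => pm i (lshift 1 j))) -expectD.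
apply: expect_le => [i j|B]; first exact: pm.
have pmr i (j : 'I_1) : is_pmf (mu i (rshift c j)) by exact: pm.
have [rB|rB] := boolP (\rank (map_mx pi B) < c)%N.
  apply: (@le_trans _ _ 1); last by rewrite lerDl.
  rewrite -[leRHS](expect1 pmr); apply: expect_le => // x.
  by rewrite lern1 leq_b1.
rewrite add0r.
apply: (@le_trans _ _ (expect (fun i (_ : 'I_1) => mu i (rshift c 0))
    (fun x => ((map_mx pi x)^T <= (map_mx pi B)^T)%MS%:R))).
  have -> : (fun i j => mu i (rshift c j)) = fun i (_ : 'I_1) => mu i (rshift c 0).
    by apply/funext => i; apply/funext => j; rewrite ord1.
  apply: expect_le => [i _|x]; first exact: pm.
  rewrite map_row_mx ler_nat.
  by case: ltnP => // rBx; rewrite (rank_row_mx_lt rBx rB).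
apply: le_trans (expect_mem_span_le _ _ (pb (rshift c 0))) _; first by [].
rewrite mxrank_tr; have -> // : \rank (map_mx pi B) = c.
by apply/eqP; rewrite eqn_leq rank_leq_col /= leqNgt.
Qed.

(** Columns are independent. One that meets the support of [u] in a free entry contributes a factor
    [rho], because the masked [u^T] then has positive rank; the others are bounded by 1. *)
Lemma expect_annihilate_le n c (fr : 'I_n -> 'I_c -> bool) (mu : 'I_n -> 'I_c -> A -> R)
    (u : 'rV[F]_n) :
  (forall i j, is_pmf (mu i j)) ->
  (forall j, partly_balanced (fr^~ j) (mu^~ j)) ->
  expect mu (fun B => (u *m map_mx pi B == 0)%:R)
    <= rho ^+ #|[pred j | [exists i, (u 0 i != 0) && fr i j]]|.
Proof.
move=> pm pb.
have -> : expect mu (fun B => (u *m map_mx pi B == 0)%:R) =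
    expect mu (fun B => \prod_j ((map_mx pi (col j B))^T *m u^T == 0)%:R).
  apply: expect_ext => B.
  have colE j : ((map_mx pi (col j B))^T *m u^T == 0) = ((u *m map_mx pi B) 0 j == 0).
    rewrite -trmx_mul trmx_eq0; apply/eqP/eqP => [/matrixP/(_ 0 0)|uB].
      by rewrite !mxE => e; rewrite -[RHS]e; apply: eq_bigr => i _; rewrite !mxE.
    apply/matrixP => i j'; rewrite !ord1 mxE [RHS]mxE -[RHS]uB mxE.
    by apply: eq_bigr => k _; rewrite !mxE.
  under eq_bigr => j _ do rewrite colE.
  have [->|/rV0Pn[j uj]] := eqVneq (u *m map_mx pi B) 0.
    by rewrite big1 // => j _; rewrite mxE eqxx.
  by rewrite (bigD1 j) //= (negPf uj) mul0r.
rewrite (expect_prod_col mu (fun j x => ((map_mx pi x)^T *m u^T == 0)%:R)).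
pose b j := [exists i, (u 0 i != 0) && fr i j].
rewrite -sum1_card -prodrXr (big_mkcond (fun j => j \in _)) /=.
apply: ler_prod => j _; apply/andP; split.
  by apply: sumr_ge0 => x _; rewrite mulr_ge0 // prodr_ge0 // => k _;
    rewrite prodr_ge0 // => i _; case: (pm i j).
apply: le_trans (expect_mulmx_eq_le_mask _ _ _ (pb j)) _; first by [].
rewrite inE -[1]/(rho ^+ 0) -(fun_if (GRing.exp rho)); apply: rho_exp_anti.
case: ifP => // /existsP[i /andP[ui frij]]; rewrite lt0n mxrank_eq0.
apply: contra ui => /eqP/matrixP/(_ i 0); rewrite !mxE frij => ->.
by rewrite eqxx.
Qed.

End RankMod.

(** * Comparison with a uniform t x t matrix *)

Section Comparison.
Variables (R : realFieldType) (A : finComUnitRingType).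
Hypothesis natA : forall a : A, exists2 k, (k <= #|A|)%N & a = k%:R.
Variables (F : finFieldType) (pi : {rmorphism A -> F}) (rho : R).
Hypothesis pi_unit : forall a, pi a != 0 -> a \is a GRing.unit.
Hypothesis pi_surj : forall x, exists a, pi a = x.
Hypothesis rho01 : 0 < rho < 1.

(** [D] spans a complement of the column span of [B], and [N] reads off the coordinates along
    [D]. *)
Definition splitting n1 t (B : 'M[A]_(n1 + t, n1)) (D : 'M[A]_(n1 + t, t))
    (K : 'M[A]_(n1, n1 + t)) (N : 'M[A]_(t, n1 + t)) : Prop :=
  [/\ B *m K + D *m N = 1%:M, N *m B = 0 & N *m D = 1%:M].

(* If the first columns [B] are independent modulo the maximal ideal, their span
   has a free complement, so that the cokernel of [row_mx B C] is that of
   [N *m C]. *)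
Lemma splitting_exists n1 t (B : 'M[A]_(n1 + t, n1)) :
  \rank (map_mx pi B) = n1 -> exists D K N, splitting B D K N.
Proof.
move=> rB; pose L := col_ebase (map_mx pi B); pose U := row_ebase (map_mx pi B).
(* [Db] consists of the last [t] columns of [L]. As [B] reduces to [L *m col_mx U 0], adjoining [Db]
   gives [L] times an invertible block-diagonal matrix. *)
pose Db : 'M[F]_(n1 + t, t) := L *m col_mx 0 1%:M.
have unitBD : row_mx (map_mx pi B) Db \in unitmx.
  have -> : row_mx (map_mx pi B) Db = L *m block_mx U 0 0 1%:M.
    have e : map_mx pi B = L *m col_mx U 0.
      rewrite -[LHS]mulmx_ebase rB -mulmxA -/L -/U; congr (_ *m _).
      by rewrite pid_mx_col mul_col_mx mul1mx mul0mx.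
    by rewrite [in LHS]e -mul_mx_row block_mxEh.
  rewrite unitmx_mul col_ebase_unit unitmxE det_ublock det1 mulr1 -unitmxE.
  exact: row_ebase_unit.
have [lft lftK] : exists lft : F -> A, forall x, pi (lft x) = x.
  by exists (fun x => sval (cid (pi_surj x))) => x; case: cid.
pose D := map_mx lft Db.
have unitN : row_mx B D \in unitmx.
  apply: (unitmx_of_residue pi_unit); rewrite map_row_mx.
  rewrite (_ : map_mx pi D = Db) //.
  by apply/matrixP => i j; rewrite !mxE lftK.
pose Q := invmx (row_mx B D); exists D, (usubmx Q), (dsubmx Q).
have := mulVmx unitN; rewrite -/Q -[Q]vsubmxK mul_col_row scalar_mx_block.
move/eq_block_mx => [_ _ NB ND]; split => //; rewrite ?col_mxKu ?col_mxKd //.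
by rewrite -mul_row_col vsubmxK mulmxV.
Qed.

Lemma prod_dist_le (c : nat) (x : 'I_c -> R) (q e : R) :
  (forall j, 0 <= x j <= 1) -> 0 <= q <= 1 -> (forall j, `|x j - q| <= e) ->
  `|\prod_j x j - q ^+ c| <= c%:R * e.
Proof.
elim: c x => [|c IH] x x01 q01 xe; first by rewrite big_ord0 subrr normr0 mul0r.
rewrite big_ord_recl exprS -natr1 mulrDl mul1r [leRHS]addrC.
set p := \prod_(i < c) _; have {}IH : `|p - q ^+ c| <= c%:R * e by exact: IH.
have p01 : 0 <= p <= 1.
  rewrite prodr_ge0 => [|i _]; last by case/andP: (x01 (lift ord0 i)).
  by apply: Num.Theory.prodr_ile1 => i _; exact: x01.
rewrite (_ : _ - _ = (x ord0 - q) * p + q * (p - q ^+ c)); last by ring.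
apply: le_trans (ler_normD _ _) _; rewrite !normrM; case/andP: p01 => p0 p1.
case/andP: q01 => q0 q1; rewrite (ger0_norm p0) (ger0_norm q0).
apply: lerD; last by apply: le_trans IH; rewrite ler_piMl.
by apply: le_trans (xe ord0); rewrite ler_piMr.
Qed.

Lemma law_bounds t n (nu : 'I_n -> A -> R) (N : 'M[A]_(t, n)) y :
  (forall i, is_pmf (nu i)) -> 0 <= law nu N y <= 1.
Proof.
move=> pm; apply/andP; split.
  rewrite -(expect_cst 0 (fun i (_ : 'I_1) => pm i)).
  by apply: expect_le => // X; exact: ler0n.
rewrite -(expect_cst 1 (fun i (_ : 'I_1) => pm i)).
by apply: expect_le => // X; rewrite lern1 leq_b1.
Qed.

Definition uniform_prob (t : nat) (Q : pred 'M[A]_t) : R :=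
  #|Q|%:R / (#|A| ^ (t * t))%:R.

Lemma uniform_prob_bounds t (Q : pred 'M[A]_t) : 0 <= uniform_prob Q <= 1.
Proof.
have A0 : (0 < #|A| ^ (t * t))%N.
  by rewrite expn_gt0; apply/orP; left; apply/card_gt0P; exists 0.
rewrite divr_ge0 //= ler_pdivrMr ?ltr0n // mul1r ler_nat -card_mx.
exact: max_card.
Qed.

(** By independence of the columns, each value of [N *m C] has as its probability a product of [t]
    laws close to the uniform one; the errors add up over at most [#|A| ^ (t * t)] values. *)
Lemma expect_mulmx_near_uniform t n (mu : 'I_n -> 'I_t -> A -> R) (N : 'M[A]_(t, n))
    (Q : pred 'M[A]_t) (e : R) :
  (forall i j, is_pmf (mu i j)) ->
  (forall j y, `|law (mu^~ j) N y - (#|A| ^ t)%:R^-1| <= e) ->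
  `|expect mu (fun C => (Q (N *m C))%:R) - uniform_prob Q|
    <= (#|A| ^ (t * t))%:R * (t%:R * e).
Proof.
move=> pm lawe; set q : R := (#|A| ^ t)%:R^-1.
have A0 : (0 < #|A| ^ t)%N.
  by rewrite expn_gt0; apply/orP; left; apply/card_gt0P; exists 0.
have q01 : 0 <= q <= 1.
  by rewrite invr_ge0 ler0n /= invf_le1 ?ltr0n // ler1n.
have -> : expect mu (fun C => (Q (N *m C))%:R) =
    \sum_(Y | Q Y) \prod_j law (mu^~ j) N (col j Y).
  under eq_bigr => Y _ do rewrite -(expect_prod_col mu (fun j x => (N *m x == col j Y)%:R)).
  rewrite -expect_sum; apply: expect_ext => C.
  have col_mul j : N *m col j C = col j (N *m C) by rewrite !colE mulmxA.
  have pE Y : \prod_j (N *m col j C == col j Y)%:R = (N *m C == Y)%:R :> R.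
    have [<-|NY] := eqVneq (N *m C) Y.
      by rewrite big1 // => j _; rewrite col_mul eqxx.
    have [j jY] : exists j, N *m col j C != col j Y.
      apply/existsP; apply: contraR NY => /existsPn NY; apply/eqP/matrixP => i j.
      have /negPn/eqP/colP/(_ i) := NY j; rewrite col_mul !mxE => <-.
      by [].
    by rewrite (bigD1 j) //= (negPf jY) mul0r.
  under eq_bigr => Y _ do rewrite pE.
  case: (boolP (Q (N *m C))) => QC.
    rewrite (bigD1 (N *m C)) //= eqxx big1 ?addr0 // => Y /andP[_].
    by rewrite eq_sym => /negPf ->.
  by rewrite big1 // => Y QY; case: eqP => // NY; rewrite NY QY in QC.
have -> : uniform_prob Q = \sum_(Y | Q Y) q ^+ t.
  by rewrite sumr_const -[RHS]mulr_natl /uniform_prob /q exprVn -natrX -expnM.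
rewrite -sumrB; apply: le_trans (ler_norm_sum _ _ _) _.
have e0 (j : 'I_t) : 0 <= e by exact: (le_trans (normr_ge0 _) (lawe j 0)).
apply: (@le_trans _ _ (\sum_(Y : 'M[A]_t | Q Y) t%:R * e)).
  apply: ler_sum => Y _; apply: prod_dist_le => // j.
  by apply: law_bounds => i.
have te0 : 0 <= t%:R * e.
  by case: t e0 {mu N Q pm lawe q A0 q01} => [|t] e0; rewrite ?mul0r // mulr_ge0 // (e0 0).
rewrite sumr_const -[leLHS]mulr_natl; apply: ler_wpM2r => //.
by rewrite ler_nat -card_mx; exact: max_card.
Qed.

Definition sparsely_annihilated n c (w : nat) (B : 'M[A]_(n, c)) : bool :=
  [exists u : 'rV[F]_n, [&& u != 0, u *m map_mx pi B == 0 &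
     (#|[set i | u ord0 i != 0%R]%SET| < w)%N]].

(** Fix [B]. On either exceptional event the difference is bounded by 1; otherwise a splitting
    exists, [row_mx B C] may be replaced by [N *m C], and [law_near_uniform] applies to each
    column. *)
Lemma compare_with_uniform n1 t (mu : 'I_(n1 + t) -> 'I_(n1 + t) -> A -> R)
    (Q : pred 'M[A]_(n1 + t)) (Q' : pred 'M[A]_t) (w : nat) (e : R) :
  (forall i j, is_pmf (mu i j)) ->
  (forall i j, balanced pi rho (mu i (rshift n1 j))) ->
  (forall B D K N, splitting B D K N -> forall C, Q (row_mx B C) = Q' (N *m C)) ->
  (0 < w)%N -> 0 <= e -> near_uniform_cst A rho t / w%:R <= e ^+ 2 ->
  `|expect mu (fun M => (Q M)%:R) - uniform_prob Q'| <=
    expect (fun i j => mu i (lshift t j)) (fun B => (\rank (map_mx pi B) < n1)%N%:R) +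
    expect (fun i j => mu i (lshift t j)) (fun B => (sparsely_annihilated w B)%:R) +
    (#|A| ^ (t * t))%:R * (t%:R * e).
Proof.
move=> pm bm QQ' w0 e0 we; rewrite expect_row.
have pml i j : is_pmf (mu i (lshift t j)) by exact: pm.
have pmr i j : is_pmf (mu i (rshift n1 j)) by exact: pm.
set E := _ * (_ * e); have E0 : 0 <= E by rewrite !mulr_ge0.
rewrite -[uniform_prob _](expect_cst _ pml) -expectB.
apply: le_trans (expect_norm_le _ pml) _.
rewrite -[E](expect_cst _ pml) -!expectD; apply: expect_le => // B.
have [u0 u1] := andP (uniform_prob_bounds Q').
have triv : `|expect (fun i j => mu i (rshift n1 j)) (fun C => (Q (row_mx B C))%:R)
    - uniform_prob Q'| <= 1.
  have Q01 C : 0 <= ((Q (row_mx B C))%:R : R) <= 1 by rewrite ler0n lern1 leq_b1.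
  have := expect_le (f := fun=> 0) (g := fun C => (Q (row_mx B C))%:R) pmr.
  have := expect_le (f := fun C => (Q (row_mx B C))%:R) (g := fun=> 1) pmr.
  rewrite !expect_cst // => h1 h0.
  have {}h1 := h1 (fun C => proj2 (andP (Q01 C))).
  have {}h0 := h0 (fun C => proj1 (andP (Q01 C))).
  by rewrite ler_norml; apply/andP; split; lra.
have [rB|] := boolP (\rank (map_mx pi B) < n1)%N.
  by apply: le_trans triv _; rewrite -addrA lerDl addr_ge0.
rewrite -leqNgt => rB.
have {}rB : \rank (map_mx pi B) = n1 by apply/eqP; rewrite eqn_leq rank_leq_col.
have [sB|/existsPn sB] := boolP (sparsely_annihilated w B).
  by apply: le_trans triv _; rewrite add0r lerDl.
rewrite !add0r; have [D [K [N sBDKN]]] := splitting_exists rB.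
have [_ NB ND] := sBDKN.
under expect_ext => C do rewrite (QQ' _ _ _ _ sBDKN).
apply: expect_mulmx_near_uniform => // j y.
rewrite -(@ler_pXn2r _ 2) ?nnegrE ?normr_ge0 // real_normK ?num_real //.
apply: le_trans we; apply: (law_near_uniform natA pi_unit) => // u uN0.
(* A sparse [u *m N] would be a sparse functional killing [B], because [N *m B = 0]; it is nonzero
   because [N *m D = 1%:M]. *)
have := sB (u *m map_mx pi N); rewrite -mulmxA -map_mxM NB map_mx0 mulmx0 eqxx /=.
rewrite negb_and -leqNgt => /orP[/negPn/eqP uN|//].
case/eqP: uN0; rewrite -[u]mulmx1 -(map_mx1 pi) -ND map_mxM mulmxA uN.
by rewrite mul0mx.
Qed.

End Comparison.
(** * Geometric sums over a staircase *)

Lemma card_ord_lt n m : (#|[pred i : 'I_n | (i < m)%N]| <= m)%N.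
Proof.
have [mn|/ltnW nm] := leqP m n; last first.
  by apply: leq_trans nm; rewrite -[leqRHS]card_ord max_card.
rewrite -sum1_card (eq_bigl (fun i : 'I_n => (i < m)%N)) => [|i]; last by rewrite inE.
by rewrite -(big_ord_widen n (fun=> 1%N) mn) sum1_card card_ord.
Qed.

Section Stairs.
Variables (R : realFieldType) (F : finFieldType) (rho : R).
Hypothesis rho01 : 0 < rho < 1.
Variables (k n1 t : nat) (alpha beta : 'I_k -> nat) (omega : nat).
Local Notation n := (n1 + t)%N.
Hypothesis omega_le : forall l, (alpha l + beta l + omega <= n)%N.

(** The power subtracted on the right lets the induction step close by an identity. *)
Lemma sum_geometric_le (x : R) N b : 0 <= x < 1 ->
  \sum_(j < N | (j < b)%N) x ^+ (b - j) <= (1 - x ^+ b.+1) / (1 - x).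
Proof.
move=> /andP[x0 x1]; have x1' : 0 < 1 - x by rewrite subr_gt0.
elim: N b => [|N IH] b.
  by rewrite big_ord0 divr_ge0 ?(ltW x1') // subr_ge0 exprn_ile1 // ltW.
case: b => [|b].
  by rewrite big_pred0 // divr_ge0 ?(ltW x1') // subr_ge0 expr1 ltW.
rewrite big_mkcond big_ord_recl /= subn0 -big_mkcond /=.
apply: (@le_trans _ _ (x ^+ b.+1 + (1 - x ^+ b.+1) / (1 - x))).
  by rewrite lerD2l; exact: IH.
by rewrite le_eqVlt; apply/orP; left; apply/eqP; rewrite [x ^+ b.+2]exprS; field;
  rewrite gt_eqF.
Qed.

Lemma sum_geometric_le_inv (x : R) N b : 0 <= x < 1 ->
  \sum_(j < N | (j < b)%N) x ^+ (b - j) <= (1 - x)^-1.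
Proof.
move=> x01; apply: le_trans (sum_geometric_le _ _ x01) _.
case/andP: x01 => x0 x1; rewrite ler_piMl ?invr_ge0 ?subr_ge0 ?(ltW x1) //.
by rewrite gerBl exprn_ge0.
Qed.

(** For a column [j] under some step, take the step [l] with [j < beta l] and the largest [alpha l]:
    at most [alpha l] entries are forced to 0, so the exponent is at least [omega + (beta l - j)]. A
    column beyond all steps has exponent [n - j = t + (n1 - j)]. Each step costs one geometric
    series, and so do the columns beyond. *)
Lemma stairs_rank_sum_le :
  \sum_(j < n1) rho ^+ (n - #|[pred i : 'I_n | in_stairs alpha beta i j]| - j) <=
  (k%:R * rho ^+ omega + rho ^+ t) / (1 - rho).
Proof.
have [r0 r1] := andP rho01.
have r01 : 0 <= rho < 1 by rewrite ltW.
apply: (@le_trans _ _ (\sum_(j < n1) (\sum_(l | (j < beta l)%N) rho ^+ (omega + (beta l - j))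
   + rho ^+ (t + (n1 - j))))).
  apply: ler_sum => j _.
  have [/existsP[l0 jl0]|/existsPn jl] := boolP [exists l, (j < beta l)%N].
    have [l jl lmax] := @arg_maxnP _ l0 (fun l => j < beta l)%N alpha jl0.
    rewrite (bigD1 l) //= -addrA -[leLHS]addr0; apply: lerD.
      apply: (rho_exp_anti rho01).
      have : (#|[pred i : 'I_n | in_stairs alpha beta i j]| <= alpha l)%N.
        apply: (@leq_trans #|[pred i : 'I_n | (i < alpha l)%N]|).
          apply/subset_leq_card/fintype.subsetP => i; rewrite !inE.
          by move=> /existsP[l' /andP[il jl']]; apply: leq_trans il (lmax _ jl').
        exact: card_ord_lt.
      have := omega_le l; lia.
    by rewrite addr_ge0 ?sumr_ge0 // => *; rewrite exprn_ge0 // ltW.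
  rewrite big_pred0 => [|l]; last by apply/negbTE/jl.
  rewrite add0r (_ : #|_| = 0%N) ?subn0.
    by apply: (rho_exp_anti rho01); have := ltn_ord j; lia.
  apply: eq_card0 => i; rewrite !inE; apply/existsPn => l; rewrite negb_and.
  by rewrite (negPf (jl l)) orbT.
rewrite big_split mulrDl; apply: lerD.
  rewrite (exchange_big_dep xpredT) //= -mulrA mulr_natl -[X in _ *+ X]card_ord -sumr_const.
  apply: ler_sum => l _; under eq_bigr => j _ do rewrite exprD.
  rewrite -mulr_sumr ler_wpM2l ?exprn_ge0 ?(ltW r0) //.
  exact: sum_geometric_le_inv.
under eq_bigr => j _ do rewrite exprD.
rewrite -mulr_sumr ler_wpM2l ?exprn_ge0 ?(ltW r0) //.
apply: le_trans (sum_geometric_le_inv n1 n1 r01).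
rewrite [leRHS](eq_bigl xpredT) // => j; exact: ltn_ord.
Qed.

Definition sparse_prefix (w m : nat) : pred 'rV[F]_n :=
  [pred u : 'rV[F]_n | [forall i, (u ord0 i != 0) ==> (i < m)%N] &&
     (#|[set i | u ord0 i != 0%R]%SET| < w)%N].

(* Weighting each nonzero entry by [z] turns the count into a product. *)
Lemma card_sparse_le (z : R) (m w : nat) : 0 < z <= 1 -> (m <= n)%N ->
  z ^+ w * #|sparse_prefix w m|%:R <= (1 + #|F|%:R * z) ^+ m.
Proof.
move=> /andP[z0 z1] mn.
pose g (i : 'I_n) (a : F) : R := if (i < m)%N then (if a != 0 then z else 1) else (a == 0)%:R.
have g0 i a : 0 <= g i a by rewrite /g; do 2?[case: ifP => _]; rewrite ?ler0n ?ler01 ?ltW.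
apply: (@le_trans _ _ (\sum_(u : 'rV[F]_n) \prod_i g i (u ord0 i))).
  rewrite -sum1_card natr_sum mulr_sumr big_mkcond; apply: ler_sum => u _.
  case: ifP => [|_]; last by apply: prodr_ge0 => i _.
  rewrite inE mulr1 => /andP[/forallP um uw].
  apply: (@le_trans _ _ (\prod_(i in [set i | u ord0 i != 0%R]%SET) z)).
    by rewrite prodr_const; apply: ler_wiXn2l => //; [exact: ltW|exact: ltnW].
  rewrite big_mkcond; apply: ler_prod => i _; rewrite inE /g.
  have := um i; case: (u ord0 i =P 0) => _ /=; first by case: ifP; rewrite ler01 lexx.
  by move=> ->; rewrite lexx (ltW z0).
have -> : \sum_(u : 'rV[F]_n) \prod_i g i (u ord0 i) =
    expect (fun _ _ _ => 1) (fun u : 'rV[F]_n => \prod_j g j (col j u 0 0)).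
  apply: eq_bigr => u _; rewrite /mx_weight [X in _ = X * _]big1 ?mul1r.
    by apply: eq_bigr => j _; rewrite mxE.
  by move=> j _; rewrite big1.
rewrite (expect_prod_col _ (fun j (x : 'cV[F]_1) => g j (x 0 0))).
rewrite (bigID (fun j : 'I_n => (j < m)%N)) /= [X in _ * X]big1 ?mulr1; last first.
  move=> j jm; rewrite expect11 (bigD1 0) //= !mxE /g (negPf jm) eqxx mulr1.
  by rewrite big1 ?addr0 // => a a0; rewrite mxE (negPf a0) mulr0.
apply: (@le_trans _ _ (\prod_(j < n | (j < m)%N) (1 + #|F|%:R * z))).
  apply: ler_prod => j jm; rewrite expect11.
  under eq_bigr => a _ do rewrite mul1r mxE.
  rewrite sumr_ge0 //= (bigD1 0) //= /g jm eqxx lerD2l.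
  under eq_bigr => a a0 do rewrite a0.
  rewrite sumr_const -[leLHS]mulr_natl ler_wpM2r ?(ltW z0) // ler_nat.
  exact: max_card.
rewrite -(big_ord_widen n (fun _ => 1 + #|F|%:R * z) mn) prodr_const card_ord.
exact: lexx.
Qed.

(** The exponent that [expect_annihilate_le] yields for the first [n1] columns of the staircase. *)
Definition stairs_hits (u : 'rV[F]_n) : nat :=
  #|[pred j : 'I_n1 | [exists i, (u ord0 i != 0) && ~~ in_stairs alpha beta i j]]|.

(** Every free column of row [i] is a hit. If some step covers row [i], take the one with the
    largest [beta l]: at least [n1 - beta l] columns are free, and adding [t] gives at least
    [alpha l + omega], hence [i.+1 + omega]. If none does, all [n1] columns are free and the
    exponent is [n]. *)
Lemma stairs_hits_le (u : 'rV[F]_n) (i : 'I_n) : u ord0 i != 0 ->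
  rho ^+ t * rho ^+ stairs_hits u <= rho ^+ n + rho ^+ (i.+1 + omega).
Proof.
move=> ui; have [r0 r1] := andP rho01.
have e0 m : 0 <= rho ^+ m by rewrite exprn_ge0 // ltW.
rewrite -exprD.
pose free := [pred j : 'I_n1 | ~~ in_stairs alpha beta i j].
have le_hits : (#|free| <= stairs_hits u)%N.
  apply/subset_leq_card/fintype.subsetP => j; rewrite !inE => ij.
  by apply/existsP; exists i; rewrite ui.
have cfree : (#|free| + #|[pred j : 'I_n1 | in_stairs alpha beta i j]| = n1)%N.
  by rewrite -[RHS]card_ord -(cardC [pred j : 'I_n1 | in_stairs alpha beta i j]) addnC.
have [/existsP[l0 il0]|/existsPn il] := boolP [exists l, (i < alpha l)%N].
  have [l il lmax] := @arg_maxnP _ l0 (fun l => i < alpha l)%N beta il0.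
  rewrite -[leLHS]add0r; apply: lerD => //; apply: (rho_exp_anti rho01).
  have : (#|[pred j : 'I_n1 | in_stairs alpha beta i j]| <= beta l)%N.
    apply: leq_trans (card_ord_lt n1 (beta l)).
    apply/subset_leq_card/fintype.subsetP => j; rewrite !inE.
    by move=> /existsP[l' /andP[il' jl]]; apply: leq_trans jl (lmax _ il').
  move: (omega_le l) cfree le_hits (il : (i < alpha l)%N).
  by clear; lia.
rewrite -[leLHS]addr0; apply: lerD => //; apply: (rho_exp_anti rho01).
have : #|[pred j : 'I_n1 | in_stairs alpha beta i j]| = 0%N.
  apply: eq_card0 => j; rewrite !inE; apply/existsPn => l; rewrite negb_and.
  by rewrite (negPf (il l)).
move: cfree le_hits; clear; lia.
Qed.

Hypothesis omega_len : (omega <= n)%N.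

(** Classify [u] by its last nonzero coordinate [i]. By [card_sparse_le] there are, up to [z ^- w],
    at most [(1 + #|F| * z) ^ i.+1] such vectors, each weighing [rho ^+ (i.+1 + omega)] in
    [stairs_hits_le]; the products are dominated by a geometric series in [sigma]. The summand 1 on
    the right pays for the terms [rho ^+ n]. *)
Lemma stairs_sparse_sum_le (z sigma : R) (w : nat) :
  0 < z <= 1 -> (1 + #|F|%:R * z) * rho <= sigma -> sigma < 1 ->
  z ^+ w * (rho ^+ t * \sum_(u : 'rV[F]_n | (u != 0) &&
       (#|[set i | u ord0 i != 0%R]%SET| < w)%N) rho ^+ stairs_hits u)
    <= sigma ^+ omega * (1 + (1 - sigma)^-1).
Proof.
move=> z01 ls s1; have [r0 r1] := andP rho01; have [z0 _] := andP z01.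
set lam := 1 + _ in ls.
have lam1 : 1 <= lam by rewrite lerDl mulr_ge0 // ltW.
have rs : rho <= sigma by apply: le_trans ls; rewrite ler_peMl // ltW.
have s0 : 0 <= sigma by apply: le_trans rs; exact: ltW.
have e0 m : 0 <= rho ^+ m by rewrite exprn_ge0 // ltW.
have card_le m : (m <= n)%N -> z ^+ w * #|sparse_prefix w m|%:R <= lam ^+ m.
  exact: card_sparse_le.
have term_le m : (m <= n)%N -> z ^+ w * \sum_(u in sparse_prefix w m) rho ^+ m <= sigma ^+ m.
  move=> mn; rewrite sumr_const -[X in _ * X]mulr_natl mulrA.
  apply: (@le_trans _ _ (lam ^+ m * rho ^+ m)).
    by apply: ler_wpM2r => //; exact: card_le.
  rewrite -exprMn; apply: lerXn2r => //.
  by rewrite nnegrE // mulr_ge0 ?(ltW r0) // (le_trans ler01).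
apply: (@le_trans _ _ (z ^+ w * (\sum_(u in sparse_prefix w n) rho ^+ n +
    \sum_(i < n) \sum_(u in sparse_prefix w i.+1) rho ^+ (i.+1 + omega)))).
  apply: ler_wpM2l; first by rewrite exprn_ge0 // ltW.
  have -> : \sum_(i < n) \sum_(u in sparse_prefix w i.+1) rho ^+ (i.+1 + omega) =
      \sum_(u in sparse_prefix w n) \sum_(i < n | u \in sparse_prefix w i.+1) rho ^+ (i.+1 + omega).
    rewrite (exchange_big_dep (mem (sparse_prefix w n))) //= => i u _.
    rewrite !inE => /andP[/forallP ui ->]; rewrite andbT; apply/forallP => i'.
    by apply/implyP.
  rewrite -big_split mulr_sumr /= big_mkcond [leRHS]big_mkcond; apply: ler_sum => u _.
  case: ifP => [/andP[u0 uw]|_]; last first.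
    by case: ifP => // _; rewrite addr_ge0 ?sumr_ge0.
  rewrite ifT; last first.
    by rewrite !inE uw andbT; apply/forallP => i; apply/implyP.
  have [i0 ui0] := rV0Pn _ u0.
  have [i ui imax] := @arg_maxnP _ i0 (fun i => u ord0 i != 0) (@nat_of_ord n) ui0.
  apply: le_trans (stairs_hits_le ui) _; rewrite lerD2l (bigD1 i) /=; last first.
    by rewrite !inE uw andbT; apply/forallP => i'; apply/implyP => /imax; rewrite ltnS.
  by rewrite lerDl sumr_ge0.
rewrite mulrDr mulrDr mulr1; apply: lerD.
  apply: le_trans (term_le n (leqnn n)) _.
  by apply: ler_wiXn2l => //; exact: ltW.
rewrite mulr_sumr.
apply: (@le_trans _ _ (\sum_(i < n) sigma ^+ omega * sigma ^+ i.+1)).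
  apply: ler_sum => i _; under eq_bigr => u _ do rewrite exprD mulrC.
  rewrite -mulr_sumr mulrCA; apply: ler_pM => //; last exact: term_le.
    by rewrite mulr_ge0 ?sumr_ge0 // exprn_ge0 // ltW.
  by apply: lerXn2r => //; rewrite nnegrE // ltW.
rewrite -mulr_sumr ler_wpM2l ?exprn_ge0 //.
apply: le_trans (@sum_geometric_le_inv sigma n n _); last by rewrite s0.
rewrite (reindex_inj rev_ord_inj) /= [leRHS](eq_bigl xpredT) => [|j].
  by apply: ler_sum => j _; rewrite subnSK.
exact: ltn_ord.
Qed.

End Stairs.
(** * Uniform square matrices over Z/p^(m+1) *)

Section ResidueField.
Variables (p m : nat).

(** The modulus of ['F_p] is derived from [pdiv p]; this divisibility makes reduction of
    representatives a ring morphism. *)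
Lemma Zp_trunc_pdiv_dvdn :
  ((Zp_trunc (pdiv p)).+2 %| (Zp_trunc (p ^ m.+1)).+2)%N.
Proof.
case: p => [|[|q]]; first by rewrite exp0n.
  by rewrite exp1n.
have gt1 : (1 < q.+2 ^ m.+1)%N by rewrite -[X in (X < _)%N](expn0 q.+2) ltn_exp2l.
have gt2 : (1 < pdiv q.+2)%N by rewrite prime_gt1 ?pdiv_prime.
by rewrite (Zp_cast gt1) (Zp_cast gt2) expnS dvdn_mulr ?pdiv_dvd.
Qed.

Definition Zp_residue (a : 'Z_(p ^ m.+1)) : 'F_p := (a : nat)%:R.

Let residue_mod (a : nat) :
  ((a %% (Zp_trunc (p ^ m.+1)).+2)%:R : 'F_p) = a%:R.
Proof. by apply: val_inj; rewrite !Zp_nat /= modn_dvdm // Zp_trunc_pdiv_dvdn. Qed.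

Let residue_zmod : zmod_morphism Zp_residue.
Proof.
move=> a b; apply/eqP; rewrite eq_sym subr_eq eq_sym; apply/eqP.
rewrite /Zp_residue -natrD -residue_mod.
by rewrite -[X in X%:R]/(nat_of_ord (a - b + b)) subrK.
Qed.
HB.instance Definition _ :=
  GRing.isZmodMorphism.Build 'Z_(p ^ m.+1) 'F_p Zp_residue residue_zmod.

Let residue_monoid : monoid_morphism Zp_residue.
Proof.
split=> [|a b]; first exact: (residue_mod 1).
by rewrite /Zp_residue -natrM; exact: residue_mod.
Qed.
HB.instance Definition _ :=
  GRing.isMonoidMorphism.Build 'Z_(p ^ m.+1) 'F_p Zp_residue residue_monoid.

Hypothesis p_pr : prime p.

Lemma Zp_exp_cast : (Zp_trunc (p ^ m.+1)).+2 = (p ^ m.+1)%N.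
Proof. by rewrite Zp_cast // -[1%N](expn0 p) ltn_exp2l // prime_gt1. Qed.

Lemma card_Zp_exp : #|'Z_(p ^ m.+1)| = (p ^ m.+1)%N.
Proof. by rewrite card_ord Zp_exp_cast. Qed.

Lemma Zp_nat_eq0 k : ((k%:R : 'Z_(p ^ m.+1)) == 0) = (p ^ m.+1 %| k)%N.
Proof.
have -> : (p ^ m.+1 %| k)%N = ((Zp_trunc (p ^ m.+1)).+2 %| k)%N by rewrite Zp_exp_cast.
by rewrite Zp_nat.
Qed.

Lemma Zp_mulp_eq0 (a : 'Z_(p ^ m.+1)) : p%:R * a = 0 -> (p ^ m %| a)%N.
Proof.
rewrite -{1}[a]natr_Zp -natrM; move: (a : nat) => b /eqP.
by rewrite Zp_nat_eq0 expnS dvdn_pmul2l ?prime_gt0.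
Qed.

Lemma Zp_residue_eq0 a : (Zp_residue a == 0) = (p %| a)%N.
Proof. by rewrite -(dvdn_pcharf (pchar_Fp p_pr)). Qed.

Lemma Zp_residue_unit a : Zp_residue a != 0 -> a \is a GRing.unit.
Proof.
rewrite Zp_residue_eq0 => pa; rewrite -[a]natr_Zp unitZpE.
  by rewrite coprimeXl // prime_coprime.
by rewrite -[1%N](expn0 p) ltn_exp2l // prime_gt1.
Qed.

Lemma Zp_residue_surj x : exists a, Zp_residue a = x.
Proof. by exists (x : nat)%:R; rewrite rmorph_nat natr_Zp. Qed.

Lemma Zp_nat_bounded (a : 'Z_(p ^ m.+1)) : exists2 k, (k <= #|'Z_(p ^ m.+1)|)%N & a = k%:R.
Proof. by exists a; rewrite ?natr_Zp // card_ord ltnW. Qed.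

End ResidueField.

Lemma additive_exists (V W : zmodType) (h : V -> W) :
  zmod_morphism h -> exists f : {additive V -> W}, f =1 h.
Proof.
move=> hB; pose hM := GRing.isZmodMorphism.Build V W h hB.
by exists (HB.pack h hM : {additive V -> W}).
Qed.

Section FiberCounting.
Variables (V W : finZmodType) (f : {additive V -> W}) (S : {set V}).
Hypothesis SB : forall x y, x \in S -> y \in S -> x - y \in S.
Hypothesis SD : forall x y, x \in S -> y \in S -> x + y \in S.

Lemma card_additive_fiber x0 : x0 \in S ->
  #|[set x in S | f x == f x0]%SET| = #|[set x in S | f x == 0%R]%SET|.
Proof.
move=> x0S; rewrite -[RHS](card_imset _ (@addrI _ x0)); apply: eq_card => x.
rewrite !inE; apply/andP/imsetP => [[xS /eqP fx]|[z]].
  exists (x - x0); last by rewrite addrC subrK.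
  by rewrite inE SB //= raddfB fx subrr.
by rewrite inE => /andP[zS /eqP fz] ->; rewrite SD // raddfD fz addr0.
Qed.

(** The first isomorphism theorem for [f] restricted to [S], in counting form. *)
Lemma card_additive_image :
  #|S| = (#|[set f x | x in S]%SET| * #|[set x in S | f x == 0%R]%SET|)%N.
Proof.
rewrite -[LHS]sum1_card (partition_big_imset f) /= -sum_nat_const.
apply: eq_bigr => y /imsetP[x0 x0S ->]; rewrite -(card_additive_fiber x0S) -sum1_card.
by apply: eq_bigl => x; rewrite !inE.
Qed.

End FiberCounting.

(** * Density of invertible matrices over Z/p^(m+1) *)

Section GLCount.
Variables (R : realFieldType) (p m : nat).
Hypothesis p_pr : prime p.
Local Notation A := 'Z_(p ^ m.+1).

Lemma card_unitmx_field (F : finFieldType) t :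
  (#|[set X : 'M[F]_t | X \in unitmx]%SET| =
    #|F| ^ 'C(t, 2) * \prod_(1 <= i < t.+1) (#|F| ^ i - 1))%N.
Proof.
(* [card_GL] concerns positive sizes, so size 0 is counted by hand. *)
case: t => [|t].
  rewrite big_nil muln1 expn0 -[RHS](_ : #|[set: 'M[F]_0]%SET| = 1%N).
    by apply: eq_card => X; rewrite !inE unitmxE det_mx00 unitr1.
  by rewrite cardsT card_mx.
rewrite -card_GL // [RHS]cardsT /= card_sub.
by apply: eq_card => X; rewrite !inE.
Qed.

(** Invertibility is decided modulo [p], and every fibre of the reduction has the size [K] of its
    kernel, so the density is the one over ['F_p]. *)
Lemma card_unitmx_Zp t :
  #|[set X : 'M[A]_t | X \in unitmx]%SET|%:R / (#|A| ^ (t * t))%:R =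
    \prod_(1 <= i < t.+1) (1 - p%:R ^- i) :> R.
Proof.
have p0 : p%:R != 0 :> R by rewrite pnatr_eq0 -lt0n prime_gt0.
pose red : 'M[A]_t -> 'M['F_p]_t := map_mx (@Zp_residue p m).
have redB : zmod_morphism red by move=> X Y; exact: map_mxB.
pose redM := GRing.isZmodMorphism.Build _ _ red redB.
pose f : {additive 'M[A]_t -> 'M['F_p]_t} := HB.pack red redM.
have red_surj Y : exists X, red X = Y.
  exists (map_mx (fun x => sval (cid (Zp_residue_surj m x))) Y).
  by apply/matrixP => i j; rewrite !mxE; case: cid.
pose K := #|[set X in [set: 'M[A]_t]%SET | f X == 0%R]%SET|.
have cA : (#|A| ^ (t * t) = p ^ (t * t) * K)%N.
  rewrite -card_mx -cardsT (card_additive_image f) ?inE //; last 2 first.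
  - by move=> *; rewrite inE.
  - by move=> *; rewrite inE.
  congr (_ * _)%N; rewrite -[in RHS](card_Fp p_pr) -card_mx -cardsT; apply: eq_card => Y.
  rewrite inE; apply/imsetP; have [X <-] := red_surj Y.
  by exists X; rewrite ?inE.
have cU : #|[set X : 'M[A]_t | X \in unitmx]%SET| =
    (#|[set X : 'M['F_p]_t | X \in unitmx]%SET| * K)%N.
  rewrite -sum1_card (partition_big red (mem [set X : 'M['F_p]_t | X \in unitmx]%SET)) /=.
    rewrite -sum_nat_const; apply: eq_bigr => Y; rewrite inE => Yu.
    have [X0 X0Y] := red_surj Y.
    rewrite /K -(@card_additive_fiber _ _ f _ _ _ X0) ?inE //; last 2 first.
    - by move=> *; rewrite inE.
    - by move=> *; rewrite inE.
    rewrite -sum1_card; apply: eq_bigl => X; rewrite !inE /= X0Y.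
    apply/andP/idP => [[]|/eqP XY] //; rewrite XY eqxx; split => //.
    by apply: (unitmx_of_residue (@Zp_residue_unit p m p_pr)); rewrite -/red XY.
  move=> X; rewrite !inE !unitmxE det_map_mx; exact: rmorph_unit.
have K0 : K%:R != 0 :> R.
  rewrite pnatr_eq0 -lt0n; apply/card_gt0P; exists 0.
  by rewrite !inE raddf0 eqxx.
rewrite cA cU !natrM -mulf_div divff // mulr1 card_unitmx_field card_Fp //.
(* The exponent [t * t] splits into a part cancelling [p ^ 'C(t, 2)] and a part dividing each factor
   [p ^ i - 1] by [p ^ i]. *)
have tt : (t * t = \sum_(0 <= i < t) i + \sum_(1 <= i < t.+1) i)%N.
  elim: t {red redB redM f red_surj K cA cU K0} => [|t IH]; first by rewrite !big_geq.
  rewrite (big_nat_recr t) // (big_nat_recr t.+1) //=; lia.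
rewrite natrM natrX -bin2_sum tt natrX exprD -mulf_div divff.
  rewrite mul1r natr_prod -prodrXr -prodf_div; apply: eq_big_nat => i /andP[i0 _].
  rewrite natrB ?expn_gt0 ?prime_gt0 // natrX mulrBl divff ?expf_neq0 //.
  by rewrite div1r.
by rewrite expf_neq0.
Qed.

End GLCount.

(** * Homomorphisms to [G] as tuples of images of basis vectors *)

Section TupleHom.
Variables (p m : nat) (G : finZmodType).
Hypothesis p_pr : prime p.
Hypothesis expG : forall g : G, g *+ (p ^ m) = 0.
Local Notation A := 'Z_(p ^ m.+1).

(** Coefficients enter through their natural representatives; the map is additive because [p ^ m]
    kills [G]. *)
Definition tuple_hom t (x : {ffun 'I_t -> G}) (v : 'cV[A]_t) : G :=
  \sum_j x j *+ (v j ord0 : nat).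

Lemma mulrn_modZp (g : G) k : g *+ (k %% (Zp_trunc (p ^ m.+1)).+2) = g *+ k.
Proof.
rewrite Zp_exp_cast // [in RHS](divn_eq k (p ^ m.+1)) mulrnDr.
by rewrite expnSr mulnA !mulrnA (mulrnAC g) expG !mul0rn add0r.
Qed.

Lemma tuple_hom_zmod t (x : {ffun 'I_t -> G}) : zmod_morphism (tuple_hom x).
Proof.
move=> u v; apply/eqP; rewrite eq_sym subr_eq -big_split; apply/eqP.
apply: eq_bigr => j _ /=; rewrite -mulrnDr -[RHS]mulrn_modZp !mxE.
congr (_ *+ _).
by rewrite -[RHS]/(nat_of_ord (u j ord0 - v j ord0 + v j ord0)) subrK.
Qed.
HB.instance Definition _ t (x : {ffun 'I_t -> G}) :=
  GRing.isZmodMorphism.Build 'cV[A]_t G (tuple_hom x) (tuple_hom_zmod x).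

Lemma tuple_hom_delta t (x : {ffun 'I_t -> G}) j : tuple_hom x (delta_mx j 0) = x j.
Proof.
rewrite /tuple_hom (bigD1 j) //= big1 ?addr0 => [|i ij].
  by rewrite mxE !eqxx.
by rewrite mxE (negPf ij).
Qed.

Lemma cV_sum_delta n (v : 'cV[A]_n) : v = \sum_j delta_mx j 0 *+ (v j ord0 : nat).
Proof.
apply/colP => i; rewrite summxE (bigD1 i) //= big1 ?addr0 => [|j ji].
  by rewrite mulmxnE mxE !eqxx natr_Zp.
by rewrite mulmxnE mxE eq_sym (negPf ji) mul0rn.
Qed.

Lemma additive_tuple_hom t (f : {additive 'cV[A]_t -> G}) :
  f =1 tuple_hom [ffun j => f (delta_mx j 0)].
Proof.
move=> v; rewrite [in LHS](cV_sum_delta v) raddf_sum; apply: eq_bigr => j _.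
by rewrite raddfMn ffunE.
Qed.

(** Exactness at the middle term of the sequence formed by [U] and [tuple_hom x]. *)
Definition exact_at t (U : 'M[A]_t) (x : {ffun 'I_t -> G}) : bool :=
  [forall v, (tuple_hom x v == 0) == [exists w : 'cV[A]_t, v == U *m w]].

Definition surj_tuple t (x : {ffun 'I_t -> G}) : bool :=
  [forall g, [exists v, tuple_hom x v == g]].

(** A surjection onto [G] with kernel the image of [U] amounts to an isomorphism from the cokernel
    of [U]. *)
Definition cok_is t (U : 'M[A]_t) : bool :=
  [exists x, surj_tuple x && exact_at U x].

(* Subgroups of [A ^ t] need at most [t] generators because the rank of finite
   abelian groups is monotone. *)
Lemma exact_at_exists t (x : {ffun 'I_t -> G}) : exists U, exact_at U x.
Proof.
pose K := [set v | tuple_hom x v == 0]%SET.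
have gK : group_set K.
  apply/group_setP; split; first by rewrite inE raddf0.
  by move=> u v; rewrite !inE => /eqP u0 /eqP v0; rewrite raddfD /= u0 v0 addr0.
pose KG := Group gK.
have mK : ('m(KG)%g <= t)%N.
  have ab (H : {group 'cV[A]_t}) : abelian H.
    by apply/centsP => u _ v _; exact: addrC.
  rewrite grank_abelian //; apply: leq_trans (rankS (finset.subsetT KG)) _.
  rewrite -grank_abelian ?ab //.
  pose B := [set (delta_mx j 0 : 'cV[A]_t) | j in 'I_t]%SET.
  have -> : [set: 'cV[A]_t]%G = <<B>>%G.
    apply/val_inj/esym/eqP; rewrite /= -finset.subTset; apply/fintype.subsetP => v _.
    rewrite (cV_sum_delta v).
    elim/big_rec: _ => [|j u _ uB]; first exact: group1.
    apply: groupM => //; elim: (nat_of_ord _) => [|k IH]; first exact: group1.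
    by rewrite mulrS; apply: groupM => //; apply/mem_gen/imset_f.
  apply: leq_trans (grank_min B) _; apply: leq_trans (leq_imset_card _ _) _.
  by rewrite card_ord.
have [B genB cB] := grank_witness KG.
(* Reading past the end gives 0, so fewer than [t] generators are padded with zero columns. *)
pose b j := nth 0 (enum B) j.
pose U : 'M[A]_t := \matrix_(i, j) b j i 0.
have Ud j : U *m delta_mx j 0 = b j.
  by rewrite -colE; apply/colP => i; rewrite !mxE.
exists U; apply/forallP => v; apply/eqP; apply/idP/existsP => [v0|[w /eqP ->]]; last first.
  have bK j : tuple_hom x (b j) = 0.
    have [jB|jB] := ltnP j (size (enum B)); last first.
      by rewrite /b nth_default // raddf0.
    have : b j \in KG by rewrite -genB mem_gen // -mem_enum mem_nth.
    by rewrite inE => /eqP.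
  rewrite (cV_sum_delta w) mulmx_sumr raddf_sum big1 // => j _.
  by rewrite (raddfMn (mulmx U)) /= Ud raddfMn /= bK mul0rn.
pose I := [set U *m w | w in {: 'cV[A]_t}]%SET.
have gI : group_set I.
  apply/group_setP; split; first by apply/imsetP; exists 0; rewrite ?mulmx0.
  move=> _ _ /imsetP[u _ ->] /imsetP[w _ ->]; apply/imsetP; exists (u + w) => //.
  by rewrite mulmxDr.
have : v \in KG by rewrite inE v0.
have BI : (<<B>> \subset Group gI)%g.
  rewrite gen_subG; apply/fintype.subsetP => u; rewrite -mem_enum => uB.
  have uBt : (index u (enum B) < t)%N.
    by apply: leq_trans mK; rewrite -cB cardE index_mem.
  apply/imsetP; exists (delta_mx (Ordinal uBt) 0) => //.
  by rewrite Ud /b nth_index.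
rewrite -genB => /(fintype.subsetP BI)/imsetP[w _ ->]; by exists w.
Qed.

End TupleHom.

(** * Counting the matrices whose image is a given kernel *)

Section CountExact.
Variables (p m : nat) (G : finZmodType).
Hypothesis p_pr : prime p.
Hypothesis expG : forall g : G, g *+ (p ^ m) = 0.
Local Notation A := 'Z_(p ^ m.+1).
Local Notation res := (@Zp_residue p m).

Lemma card_columns (T : finZmodType) r c (S : {set 'cV[T]_r}) :
  #|[set Z : 'M[T]_(r, c) | [forall j, col j Z \in S]]%SET| = (#|S| ^ c)%N.
Proof.
pose h (Z : 'M[T]_(r, c)) := [ffun j => col j Z].
have h_inj : injective h.
  move=> Y Z /ffunP YZ; apply/matrixP => i j.
  by have := YZ j; rewrite !ffunE => /colP/(_ i); rewrite !mxE.
rewrite -[in RHS](card_ord c) -card_ffun_on -(card_imset _ h_inj).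
apply: eq_card => f; apply/imsetP/ffun_onP => [[Z]|fS].
  by rewrite inE => /forallP ZS -> j; rewrite ffunE.
have hf : h (\matrix_(i, j) f j i 0) = f.
  by apply/ffunP => j; rewrite ffunE; apply/colP => i; rewrite !mxE.
exists (\matrix_(i, j) f j i 0) => //; rewrite inE; apply/forallP => j.
by move/ffunP/(_ j): hf; rewrite ffunE => ->.
Qed.

Variables (t : nat) (x : {ffun 'I_t -> G}).

Lemma exact_atP (U : 'M[A]_t) :
  reflect (forall v, tuple_hom x v = 0 <-> exists w, v = U *m w) (exact_at U x).
Proof.
apply: (iffP forallP) => h v.
  have /eqP h0 := h v; split=> [/eqP|[w vw]].
    by rewrite h0 => /existsP[w /eqP]; exists w.
  by apply/eqP; rewrite h0; apply/existsP; exists w; apply/eqP.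
apply/eqP; apply/idP/idP => [/eqP/h[w ->]|/existsP[w /eqP vw]].
  by apply/existsP; exists w.
by apply/eqP/h; exists w.
Qed.

Lemma exact_at_mulmx (U U0 : 'M[A]_t) :
  exact_at U x -> exact_at U0 x -> exists X, U = U0 *m X.
Proof.
move=> /exact_atP eU /exact_atP eU0.
have colU j : exists w, col j U = U0 *m w.
  by apply/eU0/eU; exists (delta_mx j 0); rewrite colE.
have [w wE] : exists w : 'I_t -> 'cV_t, forall j, col j U = U0 *m w j.
  by exists (fun j => sval (cid (colU j))) => j; case: cid.
exists (\matrix_(i, j) w j i 0); apply/matrixP => i j.
have /colP/(_ i) := wE j; rewrite !mxE => ->.
by apply: eq_bigr => k _; rewrite mxE.
Qed.

(** The [p]-torsion of ['Z_(p ^ m.+1)] consists of multiples of [p ^ m], which kills [G]; this uses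
    the extra power of [p] in the modulus. *)
Lemma tuple_hom_torsion (v : 'cV[A]_t) : p%:R *: v = 0 -> tuple_hom x v = 0.
Proof.
move=> pv; apply: big1 => j _; move/colP/(_ j): pv; rewrite !mxE.
move=> /(Zp_mulp_eq0 p_pr)/dvdnP[q ->].
by rewrite mulnC mulrnA expG mul0rn.
Qed.

Section Exact.
Variable U : 'M[A]_t.
Hypotheses (xS : surj_tuple p m x) (Ux : exact_at U x).

Let ker : {set 'cV[A]_t} := [set c | U *m c == 0]%SET.

(** The order of [A ^ t] is [#|G|] times that of the kernel of [tuple_hom x], and also [#|ker|]
    times that of the image of [U]; exactness identifies these two subgroups. *)
Lemma card_ker_exact : #|ker| = #|G|.
Proof.
have TB (V : finZmodType) (u v : V) : u \in [set: V]%SET -> v \in [set: V]%SET ->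
  u - v \in [set: V]%SET by rewrite !inE.
have TD (V : finZmodType) (u v : V) : u \in [set: V]%SET -> v \in [set: V]%SET ->
  u + v \in [set: V]%SET by rewrite !inE.
have c1 : #|[set: 'cV[A]_t]%SET| =
    (#|[set tuple_hom x v | v in [set: 'cV[A]_t]]%SET| *
     #|[set v in [set: 'cV[A]_t] | tuple_hom x v == 0%R]%SET|)%N.
  exact: (card_additive_image (tuple_hom x) (@TB _) (@TD _)).
have c2 : #|[set: 'cV[A]_t]%SET| =
    (#|[set U *m w | w in [set: 'cV[A]_t]]%SET| *
     #|[set w in [set: 'cV[A]_t] | U *m w == 0%R]%SET|)%N.
  exact: (card_additive_image (mulmx U) (@TB _) (@TD _)).
move: c1; rewrite c2.
have -> : #|[set tuple_hom x v | v in [set: 'cV[A]_t]]%SET| = #|G|.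
  rewrite -[RHS]cardsT; apply: eq_card => g; rewrite inE; apply/imsetP.
  have /forallP/(_ g)/existsP[v /eqP <-] := xS.
  by exists v.
have -> : [set v in [set: 'cV[A]_t] | tuple_hom x v == 0%R]%SET =
    [set U *m w | w in [set: 'cV[A]_t]]%SET.
  apply/setP => v; rewrite !inE /=; apply/eqP/imsetP.
    by case/(exact_atP U Ux) => w ->; exists w; rewrite ?inE.
  by case=> w _ ->; apply/(exact_atP U Ux); exists w.
rewrite mulnC => /eqP; rewrite eqn_pmul2r => [/eqP <-|].
  by apply: eq_card => c; rewrite !inE.
by apply/card_gt0P; exists 0; apply/imsetP; exists 0; rewrite ?inE ?mulmx0.
Qed.

(* [p] maps [S], the preimage of the [p]-torsion, into the kernel; counting both
   ways shows it is onto. *)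
Lemma ker_exact_residue (c : 'cV[A]_t) : U *m c = 0 -> map_mx res c = 0.
Proof.
move=> Uc; pose Vp : {set 'cV[A]_t} := [set v | p%:R *: v == 0]%SET.
pose S : {set 'cV[A]_t} := [set v | U *m v \in Vp]%SET.
have VpS v : v \in Vp -> v \in S by rewrite !inE scalemxAr => /eqP ->; rewrite mulmx0.
have SB u v : u \in S -> v \in S -> u - v \in S.
  by rewrite !inE mulmxBr scalerBr => /eqP -> /eqP ->; rewrite subrr.
have SD u v : u \in S -> v \in S -> u + v \in S.
  by rewrite !inE mulmxDr scalerDr => /eqP -> /eqP ->; rewrite addr0.
have kerS v : U *m v = 0 -> v \in S by rewrite !inE => ->; rewrite scaler0.
have c1 : #|S| = (#|[set U *m v | v in S]%SET| * #|[set v in S | U *m v == 0%R]%SET|)%N.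
  exact: (card_additive_image (mulmx U) SB SD).
have im1 : [set U *m v | v in S]%SET = Vp.
  apply/setP => v; apply/imsetP/idP => [[w]|vV]; first by rewrite inE => ? ->.
  have [|w vw] := (exact_atP U Ux v).1; last by exists w; rewrite // inE -vw.
  by apply: tuple_hom_torsion; apply/eqP; move: vV; rewrite inE.
have k1 : [set v in S | U *m v == 0%R]%SET = ker.
  apply/setP => v; rewrite !inE andbC; case: (U *m v =P 0) => [->|_] //.
  by rewrite scaler0 eqxx.
rewrite im1 k1 in c1.
pose f := GRing.scale (p%:R : A) : 'cV[A]_t -> 'cV[A]_t.
have c2 : #|S| = (#|[set f v | v in S]%SET| * #|[set v in S | f v == 0%R]%SET|)%N.
  exact: (card_additive_image f SB SD).
have k2 : [set v in S | f v == 0%R]%SET = Vp.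
  apply/setP => v; rewrite [LHS]inE; case: (boolP (f v == 0)) => fv; rewrite ?andbF ?andbT.
    by rewrite VpS inE.
  by rewrite inE (negPf fv).
rewrite k2 mulnC c1 in c2.
have cE : [set f v | v in S]%SET = ker.
  apply/eqP; rewrite eqEcard; apply/andP; split.
    apply/fintype.subsetP => _ /imsetP[v vS ->]; rewrite inE /f -scalemxAr.
    by move: vS; rewrite !inE.
  have : (0 < #|Vp|)%N by apply/card_gt0P; exists 0; rewrite inE scaler0.
  by move/eqP: c2 => /[swap] V0; rewrite eqn_pmul2l // => /eqP ->.
have : c \in ker by rewrite inE Uc.
rewrite -cE => /imsetP[v _ ->]; apply/colP => i; rewrite !mxE rmorphM rmorph_nat.
by rewrite (pcharf0 (pchar_Fp p_pr)) mul0r.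
Qed.

End Exact.

(* The matrices with the same image as [U0] are the [U0 *m X] with [X] invertible,
   and [X] is determined up to a matrix with columns in the kernel of [U0]. *)
Lemma card_exact_at (xS : surj_tuple p m x) :
  (#|[set U : 'M[A]_t | exact_at U x]%SET| * #|G| ^ t =
     #|[set X : 'M[A]_t | X \in unitmx]%SET|)%N.
Proof.
have [U0 eU0] := exact_at_exists p_pr expG x.
rewrite -[RHS]sum1_card (partition_big (mulmx U0) (mem [set U | exact_at U x]%SET)) /=.
  rewrite -sum_nat_const; apply: eq_bigr => U; rewrite inE => eU.
  have [X1 UX1] := exact_at_mulmx eU eU0.
  have -> : (#|G| ^ t = #|[set X in [set: 'M[A]_t] | mulmx U0 X == mulmx U0 X1]%SET|)%N.
    rewrite card_additive_fiber ?inE // => [|? ? _ _|? ? _ _]; rewrite ?inE //.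
    rewrite -(card_ker_exact xS eU0) -card_columns; apply: eq_card => X; rewrite !inE.
    apply/forallP/eqP => [UX|UX j]; last by rewrite inE colE mulmxA UX mul0mx.
    apply/matrixP => i j; have := UX j; rewrite inE colE mulmxA -colE.
    by move=> /eqP/colP/(_ i); rewrite !mxE.
  rewrite -sum1_card; apply: eq_bigl => X; rewrite !inE /= -UX1.
  apply/idP/andP => [/eqP UX|[]//]; split; last exact/eqP.
  (* From [U0 = U *m Y = U0 *m (X *m Y)], the columns of [1%:M - X *m Y] lie in the kernel of [U0],
     so they vanish modulo [p], and [X] is invertible modulo [p]. *)
  have [Y U0Y] := exact_at_mulmx eU0 eU.
  have ker1 : U0 *m (1%:M - X *m Y) = 0.
    by rewrite mulmxBr mulmx1 mulmxA UX -U0Y subrr.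
  apply: (unitmx_of_residue (@Zp_residue_unit p m p_pr)).
  have : map_mx res (1%:M - X *m Y) = 0.
    apply/matrixP => i j.
    have := ker_exact_residue eU0 (c := col j (1%:M - X *m Y)).
    by rewrite colE mulmxA ker1 mul0mx => /(_ erefl)/colP/(_ i); rewrite -colE !mxE.
  rewrite map_mxB map_mx1 map_mxM => /subr0_eq XY.
  have [uX _] := mulmx1_unit (esym XY).
  exact: uX.
move=> X; rewrite !inE => uX; apply/exact_atP => v; split.
  move/(exact_atP U0 eU0) => [w ->]; exists (invmx X *m w).
  by rewrite mulmxA mulmxK.
by case=> w ->; apply/(exact_atP U0 eU0); exists (X *m w); rewrite mulmxA.
Qed.

End CountExact.

(** * Cokernel of a uniform matrix and its limit law *)

Section UniformLimit.
Local Open Scope classical_set_scope.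
Variables (p m : nat) (G : finZmodType).
Hypothesis p_pr : prime p.
Hypothesis expG : forall g : G, g *+ (p ^ m) = 0.
Local Notation A := 'Z_(p ^ m.+1).

(** Automorphisms of [G] act by composition on these [x]. The action is free because [tuple_hom x0]
    is onto, and transitive because two surjections with the same kernel differ by an
    automorphism. *)
Lemma card_presentations t (U : 'M[A]_t) : cok_is G U ->
  #|[set x : {ffun 'I_t -> G} | surj_tuple p m x && exact_at U x]%SET| =
  #|Aut [set: G]%SET|.
Proof.
case/existsP => x0 /andP[x0S /exact_atP x0U].
have x0surj g : exists v : 'cV[A]_t, tuple_hom x0 v = g.
  by have /forallP/(_ g)/existsP[v /eqP] := x0S; exists v.
pose act (s : {perm G}) := [ffun j => s (x0 j)].
have aut0 s : s \in Aut [set: G]%SET -> s 0 = 0.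
  move=> /Aut_morphic/morphicP sM.
  have sD g h : s (g + h) = s g + s h by apply: sM; rewrite inE.
  by apply: (addrI (s 0)); rewrite -sD !addr0.
have actE s : s \in Aut [set: G]%SET -> forall v : 'cV[A]_t,
    tuple_hom (act s) v = s (tuple_hom x0 v).
  move=> sA v; have s0 := aut0 s sA; move/Aut_morphic/morphicP: sA => sM.
  have sD g h : s (g + h) = s g + s h by apply: sM; rewrite inE.
  have sMn g k : s (g *+ k) = s g *+ k.
    by elim: k => [|k IH]; rewrite ?mulr0n // !mulrS sD IH.
  rewrite /tuple_hom; elim/big_rec2: _ => [|j g h _ ->]; first by rewrite s0.
  by rewrite sD sMn ffunE.
have act_inj : {in Aut [set: G]%SET &, injective act}.
  move=> s1 s2 s1A s2A e; apply/permP => g; have [v <-] := x0surj g.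
  by rewrite -!actE // e.
rewrite -(card_in_imset act_inj); apply: eq_card => x; rewrite inE.
apply/andP/imsetP => [[xS /exact_atP xU]|[s sA ->]]; last first.
  split.
    apply/forallP => g; have [v v0] := x0surj ((s^-1)%g g).
    by apply/existsP; exists v; rewrite actE // v0 permKV.
  apply/exact_atP => v; rewrite actE // -x0U; split=> [|->].
    by rewrite -[in X in X -> _](aut0 s sA) => /perm_inj.
  exact: aut0.
have [lft lftK] : exists lft : G -> 'cV[A]_t, forall g, tuple_hom x0 (lft g) = g.
  by exists (fun g => sval (cid (x0surj g))) => g; case: cid.
have xE (u v : 'cV[A]_t) : tuple_hom x0 u = tuple_hom x0 v <-> tuple_hom x u = tuple_hom x v.
  have diff (y : {ffun 'I_t -> G}) : tuple_hom y u = tuple_hom y v <-> tuple_hom y (u - v) = 0.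
    by rewrite raddfB /=; split=> [->|/subr0_eq]; rewrite ?subrr.
  by rewrite !diff x0U xU.
(* The automorphism carrying [x0] to [x]: lift along [x0], then apply [x]. Equality of the kernels
   makes the choice of lift irrelevant. *)
pose f g := tuple_hom x (lft g : 'cV[A]_t).
have fE (v : 'cV[A]_t) : f (tuple_hom x0 v) = tuple_hom x v by apply/xE; rewrite lftK.
have f_inj : injective f by move=> g h; rewrite /f => /(proj2 (xE (lft g) (lft h))); rewrite !lftK.
exists (perm f_inj).
  rewrite inE; apply/andP; split; first by apply/fintype.subsetP => g; rewrite inE.
  apply/morphicP => g h _ _; rewrite !permE.
  have [u <-] := x0surj g; have [v <-] := x0surj h.
  rewrite -[(tuple_hom x0 u * _)%g]/(tuple_hom x0 u + tuple_hom x0 v).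
  by rewrite -raddfD !fE raddfD.
apply/ffunP => j; rewrite ffunE permE -[in RHS](@tuple_hom_delta p m _ t) fE.
by rewrite tuple_hom_delta.
Qed.

(** The entries of a non-surjective tuple lie in a proper subgroup, whose order is at most half that
    of [G]; sum over all subgroups. *)
Lemma card_nonsurj_le t :
  (#|[set x : {ffun 'I_t -> G} | ~~ surj_tuple p m x]%SET| * 2 ^ t <=
     #|{group G}| * #|G| ^ t)%N.
Proof.
apply: (@leq_trans ((\sum_(H : {group G} | H \proper [set: G]%SET) #|H| ^ t) * 2 ^ t)%N).
  rewrite leq_mul2r; apply/orP; right.
  pose P (H : {group G}) := H \proper [set: G]%SET.
  apply: (@leq_trans #|\bigcup_(H | P H) [set x : {ffun 'I_t -> G} | x \in ffun_on H]%SET|).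
    apply/subset_leq_card/fintype.subsetP => x; rewrite inE => xnS.
    pose I := [set tuple_hom x v | v in {: 'cV[A]_t}]%SET.
    have gI : group_set I.
      apply/group_setP; split; first by apply/imsetP; exists 0; rewrite ?raddf0.
      move=> _ _ /imsetP[u _ ->] /imsetP[w _ ->]; apply/imsetP; exists (u + w) => //.
      by rewrite raddfD.
    apply/bigcupP; exists (Group gI).
      rewrite /P finset.properEneq finset.subsetT andbT; apply: contra xnS => /eqP IT.
      apply/forallP => g; have : g \in I by rewrite (IT : I = finset.setTfor G) inE.
      by case/imsetP => v _ ->; apply/existsP; exists v.
    rewrite inE; apply/ffun_onP => j; apply/imsetP; exists (delta_mx j 0) => //.
    by rewrite tuple_hom_delta.
  elim/big_ind2: _ => [|S1 n1 S2 n2 h1 h2|H _].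
  - by rewrite cards0.
  - by apply: leq_trans (leq_add h1 h2); rewrite cardsU leq_subr.
  by rewrite cardsE card_ffun_on card_ord.
rewrite big_distrl /= -sum_nat_const big_mkcond; apply: leq_sum => H _.
case: ifP => // /[dup] pH /proper_sub sH.
rewrite -expnMn; case: t => // t; rewrite leq_exp2r //.
rewrite -cardsT -(Lagrange sH) leq_mul2l; apply/orP; right.
by rewrite ltn_neqAle eq_sym indexg_eq1 indexg_gt0 andbT; case/andP: pH.
Qed.

Variable R : realType.

Definition surj_ratio t : R :=
  #|[set x : {ffun 'I_t -> G} | surj_tuple p m x]%SET|%:R / (#|G| ^ t)%:R.

(** Count in two ways the pairs [(U, x)] with [x] surjective and exact at [U]: by
    [card_presentations] for fixed [U], and by [card_exact_at] for fixed [x]. *)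
Lemma uniform_cok t :
  uniform_prob R (@cok_is p m G t) =
  #|Aut [set: G]%SET|%:R^-1 * (surj_ratio t * \prod_(1 <= i < t.+1) (1 - p%:R ^- i)).
Proof.
have G0 : (#|G| ^ t)%:R != 0 :> R.
  by rewrite pnatr_eq0 -lt0n expn_gt0; apply/orP; left; apply/card_gt0P; exists 0.
have aut0 : #|Aut [set: G]%SET|%:R != 0 :> R by rewrite pnatr_eq0 -lt0n cardG_gt0.
rewrite -(card_unitmx_Zp R m p_pr t) /surj_ratio /uniform_prob.
have e : (#|@cok_is p m G t| * #|Aut [set: G]%SET| * #|G| ^ t =
    #|[set x : {ffun 'I_t -> G} | surj_tuple p m x]%SET| *
    #|[set X : 'M[A]_t | X \in unitmx]%SET|)%N.
  rewrite -!sum_nat_const big_distrl /=.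
  transitivity (\sum_(U in @cok_is p m G t)
      \sum_(x : {ffun 'I_t -> G} | surj_tuple p m x && exact_at U x) #|G| ^ t)%N.
    apply: eq_bigr => U cU; rewrite sum_nat_const -(card_presentations cU).
    by congr (_ * _)%N; apply: eq_card => x; rewrite inE.
  rewrite (exchange_big_dep (fun x => surj_tuple p m x)) /=; last by move=> U x _ /andP[].
  rewrite [RHS](eq_bigl (fun x => surj_tuple p m x)) => [|x]; last by rewrite inE.
  apply: eq_bigr => x xS; rewrite sum_nat_const -(card_exact_at p_pr expG xS).
  congr (_ * _)%N; apply: eq_card => U; rewrite !inE -[_ \in _]/(_ && _) xS /=.
  apply/andP/idP => [[]//|eU]; split => //.
  by apply/existsP; exists x; rewrite xS.
move/(congr1 (fun k => k%:R : R)): e; rewrite !natrM.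
have alg (c a g s u q : R) : a != 0 -> g != 0 -> c * a * g = s * u ->
    c * q = a^-1 * (s / g * (u * q)).
  move=> a0 g0 e; have -> : c = s * u / (a * g) by rewrite -e; field; rewrite a0 g0.
  by field; rewrite a0 g0.
exact: alg.
Qed.

Lemma surj_ratio_bounds t : 1 - #|{group G}|%:R * 2^-1 ^+ t <= surj_ratio t <= 1.
Proof.
have G0 : 0 < (#|G| ^ t)%:R :> R.
  by rewrite ltr0n expn_gt0; apply/orP; left; apply/card_gt0P; exists 0.
pose S := [set x : {ffun 'I_t -> G} | surj_tuple p m x]%SET.
have cS : (#|S| + #|~: S| = #|G| ^ t)%N.
  by rewrite cardsC card_ffun card_ord.
have nS : (#|~: S| * 2 ^ t <= #|{group G}| * #|G| ^ t)%N.
  apply: leq_trans (card_nonsurj_le t); rewrite leq_mul2r; apply/orP; right.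
  by apply/subset_leq_card/fintype.subsetP => x; rewrite !inE.
apply/andP; split; last first.
  by rewrite ler_pdivrMr // mul1r ler_nat -cS leq_addr.
rewrite ler_pdivlMr // mulrBl mul1r lerBlDr -/S -{1}cS natrD lerD2l.
rewrite exprVn mulrAC ler_pdivlMr ?exprn_gt0 // -natrX -!natrM ler_nat.
exact: nS.
Qed.

Lemma euler_prod_cvg :
  (fun N => \prod_(1 <= i < N.+1) (1 - p%:R ^- i) : R) @ \oo -->
  limn (fun N => \prod_(1 <= i < N.+1) (1 - p%:R ^- i) : R).
Proof.
have p01 i : 0 <= (1 - p%:R ^- i : R) <= 1.
  rewrite gerBl invr_ge0 exprn_ge0 // andbT subr_ge0 invf_le1 ?exprn_gt0 ?ltr0n ?prime_gt0 //.
  by rewrite exprn_ege1 // ler1n prime_gt0.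
have prod_ge0 N : 0 <= \prod_(1 <= i < N.+1) (1 - p%:R ^- i) :> R.
  by apply: prodr_ge0 => i _; case/andP: (p01 i).
apply: nonincreasing_is_cvgn.
  apply/nonincreasing_seqP => n; rewrite big_nat_recr //=; apply: ler_piMr => //.
by exists 0 => _ [N _ <-].
Qed.

Lemma uniform_cok_cvg :
  (fun t => uniform_prob R (@cok_is p m G t)) @ \oo -->
  #|Aut [set: G]%SET|%:R^-1 * limn (fun N => \prod_(1 <= i < N.+1) (1 - p%:R ^- i) : R).
Proof.
under eq_fun => t do rewrite uniform_cok.
apply: cvgMr; rewrite -[X in _ --> X]mul1r; apply: cvgM; last exact: euler_prod_cvg.
apply: (@squeeze_cvgr _ _ _ _ (fun t => 1 - #|{group G}|%:R * 2^-1 ^+ t) (fun=> 1)).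
- by near=> t; exact: surj_ratio_bounds.
- rewrite -[X in _ --> X]subr0; apply: cvgB; first exact: cvg_cst.
  rewrite -[X in _ --> X](mulr0 #|{group G}|%:R); apply: cvgMr.
  by apply: cvg_expr; rewrite ger0_norm // invf_lt1 // ltr1n.
- exact: cvg_cst.
Unshelve. all: by end_near.
Qed.

End UniformLimit.
(** * Cokernels over the p-adic integers *)

Section Presentation.
Local Open Scope quotient_scope.

(** Isomorphism with the cokernel, phrased without the quotient so that it can be moved along a
    change of ring or of size. *)
Definition presents (A : comNzRingType) n (M : 'M[A]_n) (G : zmodType) : Prop :=
  exists f : {additive 'cV[A]_n -> G}, (forall g, exists v, f v = g) /\
    (forall v, f v = 0 <-> exists w, v = M *m w).

Lemma zmod_isog_cokP (A : comNzRingType) n (M : 'M[A]_n) (G : zmodType) :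
  zmod_isog (cok M) G <-> presents M G.
Proof.
have col_imageE v : (v \in col_image M) <-> exists w, v = M *m w.
  by split=> [/asboolP|h]; last exact/asboolP.
split=> [[g [h gK hK]]|[f [fS fM]]].
  exists (g \o \pi_(cok M)); split=> [y|v] /=.
    by exists (generic_quotient.repr (h y)); rewrite /= reprK hK.
  rewrite -col_imageE -{2}[v]subr0 Quotient.idealrBE.
  split=> [gv|/eqP ->]; last by rewrite !raddf0.
  by apply/eqP/(can_inj gK); rewrite gv !raddf0.
have f_repr v : f (generic_quotient.repr (\pi_(cok M) v)) = f v.
  apply/subr0_eq; rewrite -raddfB; apply/fM/col_imageE.
  by rewrite Quotient.idealrBE reprK.
pose g (q : cok M) := f (generic_quotient.repr q).
have gB : zmod_morphism g.
  move=> q1 q2; rewrite /g -raddfB -[RHS]f_repr; congr (f (generic_quotient.repr _)).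
  by rewrite raddfB /= !reprK.
have [gA gAE] := additive_exists gB.
exists gA; exists (fun y => \pi_(cok M) (sval (cid (fS y)))) => [q|y] /=.
  case: cid => v /= fv; rewrite -[RHS]reprK; apply/eqP; rewrite -Quotient.idealrBE.
  by apply/col_imageE/fM; rewrite raddfB fv gAE subrr.
by rewrite gAE /g f_repr; case: cid.
Qed.

(** Since [x = B *m (K *m x) + D *m (N *m x)], a vector is determined by [N *m x] modulo the span of
    [B]. Presentations are transported by composing with [D] one way and with [N] the other way. *)
Lemma presents_splitting (A : comNzRingType) n1 t (B : 'M[A]_(n1 + t, n1))
    (D C : 'M[A]_(n1 + t, t)) (K : 'M[A]_(n1, n1 + t)) (N : 'M[A]_(t, n1 + t))
    (G : zmodType) :
  B *m K + D *m N = 1%:M -> N *m B = 0 -> N *m D = 1%:M ->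
  presents (row_mx B C) G <-> presents (N *m C) G.
Proof.
move=> BKDN NB ND.
have vE (x : 'cV[A]_(n1 + t)) : x = B *m (K *m x) + D *m (N *m x).
  by rewrite !mulmxA -mulmxDl BKDN mul1mx.
split=> [[f [fS fM]]|[f [fS fM]]].
  exists (f \o mulmx D); split=> [g|z] /=.
    have [w <-] := fS g; exists (N *m w); rewrite /= [in RHS](vE w).
    rewrite raddfD /= (_ : f (B *m _) = 0) ?add0r //.
    apply/fM; exists (col_mx (K *m w) 0).
    by rewrite mul_row_col mulmx0 addr0.
  rewrite fM; split=> [[w Dz]|[w ->]].
    exists (dsubmx w); rewrite -[z]mul1mx -ND -!mulmxA Dz -[w in LHS]vsubmxK mul_row_col.
    by rewrite mulmxDr !mulmxA NB mul0mx add0r.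
  exists (col_mx (- (K *m (C *m w))) w); rewrite mul_row_col mulmxN.
  apply: (addrI (B *m (K *m (C *m w)))); rewrite addrA subrr add0r.
  by rewrite [in RHS](vE (C *m w)) !mulmxA.
exists (f \o mulmx N); split=> [g|v] /=.
  have [z <-] := fS g; exists (D *m z); by rewrite /= mulmxA ND mul1mx.
rewrite fM; split=> [[w Nv]|[w ->]]; last first.
  by exists (dsubmx w); rewrite -[w in LHS]vsubmxK mul_row_col mulmxDr !mulmxA NB mul0mx add0r.
exists (col_mx (K *m v - K *m (C *m w)) w); rewrite mul_row_col mulmxBr addrAC.
rewrite [in LHS](vE v) Nv -!addrA; congr (_ + _).
by apply/eqP; rewrite eq_sym subr_eq addrC -[N *m C *m w]mulmxA; apply/eqP/vE.
Qed.

End Presentation.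

Section PresentationZp.
Variables (p m : nat) (G : finZmodType).
Hypothesis p_pr : prime p.
Hypothesis expG : forall g : G, g *+ (p ^ m) = 0.
Local Notation A := 'Z_(p ^ m.+1).

Lemma presentsP t (U : 'M[A]_t) : reflect (presents U G) (cok_is G U).
Proof.
apply: (iffP existsP) => [[x /andP[/forallP xS /exact_atP xU]]|[f [fS fU]]].
  have [f fE] := additive_exists (tuple_hom_zmod p_pr expG x).
  exists f; split=> [g|v]; last by rewrite fE.
  by have /existsP[v /eqP] := xS g; exists v; rewrite fE.
exists [ffun j => f (delta_mx j 0)]; apply/andP; split.
  apply/forallP => g; have [v <-] := fS g; apply/existsP; exists v.
  by rewrite -(additive_tuple_hom f).
by apply/exact_atP => v; rewrite -(additive_tuple_hom f).
Qed.

End PresentationZp.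

(** * Reduction of p-adic matrices modulo p^(m+1) *)

Section PadicReduction.
Variable p : nat.
Hypothesis p_pr : prime p.

Lemma Zp_nat_eqmod m a b :
  (a%:R = b%:R :> 'Z_(p ^ m.+1)) <-> (a = b %[mod p ^ m.+1])%N.
Proof.
have -> : (a = b %[mod p ^ m.+1])%N <-> (a = b %[mod (Zp_trunc (p ^ m.+1)).+2])%N.
  by rewrite Zp_exp_cast.
rewrite !Zp_nat; split=> [/(congr1 val)|ab] //.
exact: val_inj.
Qed.

Lemma padic_res_modS m (x : padic p) :
  (padic_res m.+1 x : nat) = padic_res m x %[mod p ^ m.+1].
Proof.
by apply/(Zp_nat_eqmod m); rewrite natr_Zp; exact: (padic_seqP x m).
Qed.

Lemma padic_res_mod m k (x : padic p) :
  (padic_res (m + k) x : nat) = padic_res m x %[mod p ^ m.+1].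
Proof.
elim: k => [|k IH]; first by rewrite addn0.
rewrite addnS -IH; have := padic_res_modS (m + k) x.
move=> /(congr1 (fun u => u %% p ^ m.+1)%N); rewrite !modn_dvdm ?dvdn_exp2l //.
  by rewrite ltnS leq_addr.
by rewrite ltnS leq_addr.
Qed.

Lemma padic_lift_res m (a : 'Z_(p ^ m.+1)) : padic_res m ((a : nat)%:R : padic p) = a.
Proof. by rewrite rmorph_nat natr_Zp. Qed.

(** Dividing the residue modulo [p ^ (m + k + 2)] by [p ^ m.+1] gives the residue of the quotient
    modulo [p ^ k.+1]. *)
Lemma padic_res0_dvd m (x : padic p) :
  padic_res m x = 0 -> exists y, x = (p ^ m.+1)%:R * y.
Proof.
move=> x0; pose P := (p ^ m.+1)%N; have P0 : (0 < P)%N by rewrite expn_gt0 prime_gt0.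
pose y k : 'Z_(p ^ k.+1) := (padic_res (m.+1 + k) x %/ P)%:R.
have Px k : (P %| padic_res (m.+1 + k) x)%N.
  rewrite addSn -addnS; apply/dvdnP.
  have := padic_res_mod m k.+1 x; rewrite x0 mod0n => /eqP.
  by move=> /dvdnP.
have yP k : ((y k.+1 : nat)%:R : 'Z_(p ^ k.+1)) = y k.
  rewrite /y padic_natP; apply/Zp_nat_eqmod/eqP.
  rewrite -(eqn_pmul2l P0) !muln_modr [(P * (_ %/ _))%N]mulnC divnK //.
  rewrite [X in _ == X %[mod _]]mulnC divnK // -expnD addSnnS addSn.
  by apply/eqP; rewrite !addnS; exact: padic_res_modS.
exists (Padic yP); apply: padicP => k.
have -> : padic_res k ((p ^ m.+1)%:R * Padic yP) = (p ^ m.+1)%:R * y k.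
  by rewrite rmorphM rmorph_nat.
rewrite /y -natrM mulnC divnK // -[LHS]natr_Zp; apply/Zp_nat_eqmod.
by rewrite addnC padic_res_mod.
Qed.

Lemma padic_unit (x : padic p) : padic_res 0 x = 1 -> exists y, x * y = 1.
Proof.
move=> x1.
have ux m : padic_res m x \is a GRing.unit.
  apply: (Zp_residue_unit p_pr); rewrite Zp_residue_eq0 //.
  have := padic_res_mod 0 m x; rewrite add0n x1 expn1 => e.
  rewrite /dvdn e.
  by rewrite modn_small ?prime_gt1.
pose y m := (padic_res m x)^-1.
have yP m : ((y m.+1 : nat)%:R : 'Z_(p ^ m.+1)) = y m.
  apply: (mulrI (ux m)); rewrite [RHS](mulrV (ux m)).
  have -> : padic_res m x = (padic_res m.+1 x : nat)%:R by rewrite (padic_seqP x m).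
  rewrite -natrM -[RHS]/(1%:R); apply/Zp_nat_eqmod.
  have : ((padic_res m.+1 x : nat) * (y m.+1 : nat))%N%:R = 1%:R :> 'Z_(p ^ m.+2).
    by rewrite natrM !natr_Zp; exact: (mulrV (ux m.+1)).
  move/(Zp_nat_eqmod m.+1)/(congr1 (fun u => u %% p ^ m.+1)%N).
  by rewrite !modn_dvdm ?dvdn_exp2l.
exists (Padic yP); apply: padicP => m.
by rewrite rmorphM rmorph1; exact: (mulrV (ux m)).
Qed.

Variables (m : nat) (G : finZmodType).
Hypothesis expG : forall g : G, g *+ (p ^ m) = 0.
Local Notation res := (@padic_res p m).

Definition mx_lift r c (X : 'M['Z_(p ^ m.+1)]_(r, c)) : 'M[padic p]_(r, c) :=
  map_mx (fun a : 'Z_(p ^ m.+1) => (a : nat)%:R) X.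

Lemma mx_liftK r c (X : 'M['Z_(p ^ m.+1)]_(r, c)) : map_mx res (mx_lift X) = X.
Proof. by apply/matrixP => i j; rewrite !mxE padic_lift_res. Qed.

Lemma mx_res_eq_dvd r c (X Y : 'M[padic p]_(r, c)) :
  map_mx res X = map_mx res Y -> exists Z, X = Y + (p ^ m.+1)%:R *: Z.
Proof.
move=> XY.
have d i j : exists z, X i j - Y i j = (p ^ m.+1)%:R * z.
  apply: padic_res0_dvd; rewrite rmorphB /=.
  by move/matrixP/(_ i j): XY; rewrite !mxE => ->; rewrite subrr.
exists (\matrix_(i, j) sval (cid (d i j))); apply/matrixP => i j.
by rewrite !mxE; case: cid => z /= <-; rewrite addrC subrK.
Qed.

(** The determinant is 1 modulo [p], hence a unit, and the adjugate supplies the inverse. *)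
Lemma inv_1_sub_p n (Y : 'M[padic p]_n) : exists X, (1%:M - p%:R *: Y) *m X = 1%:M.
Proof.
have [u du] : exists u, \det (1%:M - p%:R *: Y) * u = 1.
  apply: padic_unit; rewrite -det_map_mx map_mxB map_mx1 map_mxZ rmorph_nat.
  have -> : p%:R = 0 :> 'Z_(p ^ 1) by apply/eqP; rewrite Zp_nat_eq0 // expn1.
  by rewrite scale0r subr0 det1.
exists (u *: \adj (1%:M - p%:R *: Y)).
by rewrite -scalemxAr mul_mx_adj scale_scalar_mx mulrC du.
Qed.

(** A map to [G] factors through residues because [p ^ m] kills [G]. Conversely, the kernel of the
    lifted map consists of the image of [M] together with multiples of [p ^ m.+1], and a Nakayama
    argument puts these multiples into the image. *)
Lemma presents_padic n (M : 'M[padic p]_n) :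
  presents M G <-> presents (map_mx res M) G.
Proof.
split=> [[f [fS fM]]|[g [gS gM]]].
  have f_res u v : map_mx res u = map_mx res v -> f u = f v.
    move=> /mx_res_eq_dvd[z ->]; rewrite raddfD /= scaler_nat raddfMn.
    by rewrite expnSr mulrnA expG mul0rn addr0.
  have gB : zmod_morphism (fun w => f (mx_lift w)).
    by move=> a b; rewrite -raddfB; apply: f_res; rewrite map_mxB !mx_liftK.
  have [g gE] := additive_exists gB; exists g; split=> [y|w].
    have [v <-] := fS y; exists (map_mx res v); rewrite gE.
    by apply: f_res; rewrite mx_liftK.
  rewrite gE fM; split=> [[z wz]|[z ->]].
    by exists (map_mx res z); rewrite -map_mxM -wz mx_liftK.
  apply/fM; rewrite (f_res _ (M *m mx_lift z)); first by apply/fM; exists (mx_lift z).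
  by rewrite map_mxM !mx_liftK.
have fB : zmod_morphism (fun v : 'cV[padic p]_n => g (map_mx res v)).
  by move=> a b; rewrite map_mxB raddfB.
have [f fE] := additive_exists fB; exists f; split=> [y|v].
  by have [w <-] := gS y; exists (mx_lift w); rewrite fE mx_liftK.
have im_dvd (w : 'cV[padic p]_n) : f w = 0 -> exists z y, w = M *m z + (p ^ m.+1)%:R *: y.
  rewrite fE => /gM[z wz]; have [|y wE] := @mx_res_eq_dvd _ _ w (M *m mx_lift z).
    by rewrite map_mxM mx_liftK.
  by exists (mx_lift z), y.
have fMn (w : 'cV[padic p]_n) : f ((p ^ m)%:R *: w) = 0 by rewrite scaler_nat raddfMn expG.
have pp : (p ^ m)%:R * p%:R = (p ^ m.+1)%:R :> padic p by rewrite -natrM -expnSr.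
(* The kernel contains [p ^ m] times each basis vector, so [p ^ m *: (1%:M - p *: Y) = M *m Z] for
   some [Y] and [Z], and the factor [1%:M - p *: Y] is invertible. *)
have [W MW] : exists W : 'M[padic p]_n, (p ^ m)%:R%:M = M *m W.
  have dec j := im_dvd _ (fMn (delta_mx j 0)).
  pose z j := sval (cid (dec j)).
  have zP j : exists y, (p ^ m)%:R *: delta_mx j 0 = M *m z j + (p ^ m.+1)%:R *: y.
    by rewrite /z; case: cid.
  pose y j := sval (cid (zP j)).
  have yP j : (p ^ m)%:R *: delta_mx j 0 = M *m z j + (p ^ m.+1)%:R *: y j.
    by rewrite /y; case: cid.
  pose Z := \matrix_(i, j) z j i 0; pose Y := \matrix_(i, j) y j i 0.
  have [X YX] := inv_1_sub_p Y.
  have MZ : (p ^ m)%:R *: (1%:M - p%:R *: Y) = M *m Z.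
    apply/matrixP => i j; have /colP/(_ i) := yP j.
    rewrite !mxE eqxx andbT => e.
    rewrite mulrBr mulrA pp e addrK.
    by apply: eq_bigr => k _; rewrite mxE.
  exists (Z *m X); rewrite mulmxA -MZ -scalemxAl YX.
  by rewrite scale_scalar_mx mulr1.
split=> [/im_dvd[z [y ->]]|[w ->]]; last first.
  by rewrite fE; apply/gM; exists (map_mx res w); rewrite map_mxM.
exists (z + W *m (p%:R *: y)); rewrite mulmxDr mulmxA -MW mul_scalar_mx scalerA.
by rewrite pp.
Qed.

End PadicReduction.
(** * Reduction of the theorem to finite sums *)

Section FiniteLaw.
Local Open Scope classical_set_scope.
Context {d : measure_display} {T : measurableType d} {R : realType}.
Variable P : probability T R.

Lemma measure_preimage_fin (I : finType) (X : T -> I) (Q : pred I) :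
  (forall i, measurable [set t | X t = i]) ->
  P [set t | Q (X t)] = (\sum_(i | Q i) P [set t | X t = i])%E.
Proof.
move=> mX; have -> : [set t | Q (X t)] = \bigcup_(i in [set` Q]) [set t | X t = i].
  apply/seteqP; split=> [t /= Qt|t [i /= Qi Xi]]; first by exists (X t).
  by rewrite Xi.
rewrite measure_fin_bigcup //; last by move=> i j _ _ [t [/= <- <-]].
have -> : [set` Q] = [set` enum Q] by apply/seteqP; split=> i /=; rewrite mem_enum.
by rewrite -fsbig_seq ?enum_uniq // big_enum.
Qed.

Lemma measurable_padic_res p m (r : 'Z_(p ^ m.+1)) :
  measurable [set x : padic p | padic_res m x = r].
Proof. by apply: sub_sigma_algebra; exists m, r. Qed.

Variables (p m n k : nat) (eps : R) (alpha beta : 'I_k -> nat).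
Variable M : T -> 'M[padic p]_n.
Hypothesis p_pr : prime p.
Hypothesis HM : eps_balanced_stairs_matrix P eps alpha beta M.

Definition entry_law (i j : 'I_n) (a : 'Z_(p ^ m.+1)) : R :=
  fine (P [set t | padic_res m (M t i j) = a]).

Lemma measurable_entry_res i j (a : 'Z_(p ^ m.+1)) :
  measurable [set t | padic_res m (M t i j) = a].
Proof.
have [M0 Mfree _] := HM.
have [ij|ij] := boolP (in_stairs alpha beta i j).
  have [a0|a0] := eqVneq (padic_res m (0 : padic p)) a.
    by rewrite (_ : mkset _ = setT) //; apply/seteqP; split=> t //= _; rewrite M0.
  rewrite (_ : mkset _ = set0) //; apply/seteqP; split=> t //=; rewrite M0 // => e.
  by rewrite e eqxx in a0.
have [mM _] := Mfree i j ij.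
have := mM measurableT _ (measurable_padic_res a).
by rewrite setTI.
Qed.

Lemma entry_lawE i j a :
  P [set t | padic_res m (M t i j) = a] = (entry_law i j a)%:E.
Proof. by rewrite fineK // fin_num_measure //; exact: measurable_entry_res. Qed.

Lemma entry_law_pmf i j : is_pmf (entry_law i j).
Proof.
split=> [a|]; first by rewrite -lee_fin -entry_lawE.
apply: EFin_inj; rewrite -sumEFin; under eq_bigr do rewrite -entry_lawE.
rewrite -(@measure_preimage_fin _ (fun t => padic_res m (M t i j)) predT).
  by rewrite (_ : mkset _ = setT) ?probability_setT //; apply/seteqP; split.
by move=> a; exact: measurable_entry_res.
Qed.

(** Balancedness is stated with the residue of index 0, of modulus [p ^ 1], whereas [Zp_residue]
    takes values in ['F_p]. *)
Lemma Zp_residue_padic_res (x : padic p) (r : 'F_p) :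
  (Zp_residue (padic_res m x) == r) = (padic_res 0 x == (r : nat)%:R).
Proof.
have eqmod1 a b : (a%:R = b%:R :> 'Z_(p ^ 1)) <-> (a = b %[mod p])%N.
  by rewrite (Zp_nat_eqmod p_pr) expn1.
have e : (padic_res m x : nat) = padic_res 0 x %[mod p].
  have := padic_res_mod p_pr 0 m x; rewrite add0n.
  by move: (nat_of_ord _) (nat_of_ord _) => a b; rewrite expn1.
have rp : (r < p)%N by rewrite -[ltnRHS](Fp_cast p_pr) ltn_ord.
rewrite -[padic_res 0 x]natr_Zp -(inj_eq val_inj) /= /Zp_residue val_Fp_nat // e.
move: (padic_res 0 x : nat) => v.
by apply/eqP/eqP => [vr|/eqmod1 ->]; [apply/eqmod1; rewrite vr|]; rewrite modn_small.
Qed.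

Lemma entry_law_stairs (i j : 'I_n) a :
  in_stairs alpha beta i j -> entry_law i j a = (a == 0)%:R.
Proof.
have [M0 _ _] := HM; move=> ij; apply: EFin_inj; rewrite -entry_lawE.
have [->|a0] := eqVneq a 0.
  rewrite (_ : mkset _ = setT) ?probability_setT //.
  by apply/seteqP; split=> t //= _; rewrite M0 // rmorph0.
rewrite (_ : mkset _ = set0) ?measure0 //.
by apply/seteqP; split=> t //=; rewrite M0 // rmorph0 => e; rewrite -e eqxx in a0.
Qed.

Lemma entry_law_partly_balanced (j : 'I_n) :
  partly_balanced (@Zp_residue p m) (1 - eps)
    (fun i : 'I_n => ~~ in_stairs alpha beta i j) (entry_law^~ j).
Proof.
move=> i; have [M0 Mfree _] := HM; case: ifPn => [ij r|/negPn ij a a0].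
  rewrite -lee_fin -sumEFin; under eq_bigr do rewrite -entry_lawE.
  rewrite -(@measure_preimage_fin _ (fun t => padic_res m (M t i j))
    (fun a => Zp_residue a == r)); last by move=> a; exact: measurable_entry_res.
  have [_ bal] := Mfree i j ij; apply: le_trans (bal (r : nat)%:R).
  rewrite (_ : mkset _ = [set t | padic_res 0 (M t i j) = (r : nat)%:R]) //.
  by apply/seteqP; split=> t /=; rewrite Zp_residue_padic_res => /eqP.
by rewrite entry_law_stairs // (negPf a0).
Qed.

(** Independence concerns the free entries. A forced entry contributes the factor 1 when [X]
    vanishes there; otherwise both sides are 0. *)
Lemma matrix_law (X : 'M['Z_(p ^ m.+1)]_n) :
  P [set t | map_mx (@padic_res p m) (M t) = X] = (mx_weight entry_law X)%:E.
Proof.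
have [M0 Mfree Mind] := HM.
pose D := [set ij : 'I_n * 'I_n | ~~ in_stairs alpha beta ij.1 ij.2]%SET.
pose B (ij : 'I_n * 'I_n) := [set x : padic p | padic_res m x = X ij.1 ij.2].
have wE : mx_weight entry_law X = \prod_ij entry_law ij.1 ij.2 (X ij.1 ij.2).
  rewrite /mx_weight exchange_big /=.
  by rewrite (pair_bigA _ (fun i j => entry_law i j (X i j))).
have [/forallP X0|/forallPn[[i j]]] :=
    boolP [forall ij, (ij \notin D) ==> (X ij.1 ij.2 == 0)]; last first.
  rewrite negb_imply inE negbK /= => /andP[ij Xij].
  rewrite wE (bigD1 (i, j)) //= entry_law_stairs // (negPf Xij) mul0r.
  rewrite (_ : mkset _ = set0) ?measure0 //; apply/seteqP; split=> t //= tX.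
  by move: Xij; rewrite -tX mxE M0 // rmorph0 eqxx.
have := Mind D B (fintype.subxx _) (fun ij _ => measurable_padic_res _).
have -> : \bigcap_(ij in [set` D]) ((fun t => M t ij.1 ij.2) @^-1` B ij) =
    [set t | map_mx (@padic_res p m) (M t) = X].
  apply/seteqP; split=> t /=.
    move=> tB; apply/matrixP => i j; rewrite mxE.
    have [ijD|ijD] := boolP ((i, j) \in D); first exact: (tB (i, j) ijD).
    have := X0 (i, j); rewrite ijD => /eqP /= ->.
    by rewrite M0 ?rmorph0 //; move: ijD; rewrite inE negbK.
  by move=> tX ij _; rewrite /B /= -tX mxE.
move=> ->; rewrite wE -prodEFin [RHS](bigID (mem D)) /= [X in _ = (_ * X)%E]big1 ?mule1.
  by apply: eq_bigr => ij _; rewrite -entry_lawE.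
move=> ij ijD; have := X0 ij; rewrite ijD => /eqP ->.
by rewrite entry_law_stairs ?eqxx //; move: ijD; rewrite inE negbK.
Qed.

Lemma stairs_event_prob (G : finZmodType) : (forall g : G, g *+ (p ^ m) = 0) ->
  P [set t | zmod_isog (cok (M t)) G] =
    (expect entry_law (fun X => (cok_is G X)%:R))%:E.
Proof.
move=> expG; have -> : [set t | zmod_isog (cok (M t)) G] =
    [set t | cok_is G (map_mx (@padic_res p m) (M t))].
  apply/seteqP; split=> t /=.
    by move=> /zmod_isog_cokP/(presents_padic p_pr expG)/(presentsP p_pr expG).
  by move=> /(presentsP p_pr expG)/(presents_padic p_pr expG)/zmod_isog_cokP.
rewrite (@measure_preimage_fin _ (fun t => map_mx (@padic_res p m) (M t)) (@cok_is p m G n)).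
  under eq_bigr do rewrite matrix_law.
  rewrite sumEFin; congr EFin; rewrite big_mkcond; apply: eq_bigr => X _ /=.
  by case: ifP => _; rewrite ?mulr1 ?mulr0.
move=> X; have -> : [set t | map_mx (@padic_res p m) (M t) = X] =
    \bigcap_(ij in [set: 'I_n * 'I_n]) [set t | padic_res m (M t ij.1 ij.2) = X ij.1 ij.2].
  apply/seteqP; split=> t /= tX; first by move=> ij _; rewrite /= -tX mxE.
  by apply/matrixP => i j; rewrite mxE; exact: (tX (i, j)).
apply: fin_bigcap_measurable; first exact: finite_finset.
by move=> ij _; exact: measurable_entry_res.
Qed.

End FiniteLaw.

(** * Explicit error bound for a staircase matrix *)

Section StairsComparison.
Variables (R : realType) (p m k n1 t : nat) (alpha beta : 'I_k -> nat) (omega : nat).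
Variables (rho : R) (G : finZmodType).
Hypothesis p_pr : prime p.
Hypothesis rho01 : 0 < rho < 1.
Hypothesis expG : forall g : G, g *+ (p ^ m) = 0.
Hypothesis omega_le : forall l, (alpha l + beta l + omega <= n1 + t)%N.
Hypothesis omega_len : (omega <= n1 + t)%N.
Hypothesis t_omega : (t <= omega)%N.
Local Notation A := 'Z_(p ^ m.+1).

Definition sigma_rate (r : R) : R := (1 + r) / 2.

(* The three terms bound, in this order, the probability that the first [n1]
   columns are dependent modulo [p], the probability that their span modulo [p]
   is killed by a nonzero functional with fewer than [w] nonzero coordinates, and
   the distance to uniform otherwise. The weight [(1 - rho) / (2 * p)] is chosen
   so that [(1 + p * weight) * rho <= sigma_rate rho < 1]. *)
Definition stairs_error (w : nat) (e : R) : R :=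
  (k%:R * rho ^+ omega + rho ^+ t) / (1 - rho) +
  sigma_rate rho ^+ omega * (1 + (1 - sigma_rate rho)^-1) /
     (((1 - rho) / (2 * p%:R)) ^+ w * rho ^+ t) +
  (#|A| ^ (t * t))%:R * (t%:R * e).

Lemma stairs_compare (mu : 'I_(n1 + t) -> 'I_(n1 + t) -> A -> R) (w : nat) (e : R) :
  (forall i j, is_pmf (mu i j)) ->
  (forall j : 'I_(n1 + t), partly_balanced (@Zp_residue p m) rho
     (fun i : 'I_(n1 + t) => ~~ in_stairs alpha beta i j) (mu^~ j)) ->
  (0 < w)%N -> 0 <= e -> near_uniform_cst A rho t / w%:R <= e ^+ 2 ->
  `|expect mu (fun X => (cok_is G X)%:R) - uniform_prob R (@cok_is p m G t)|
    <= stairs_error w e.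
Proof.
move=> pm pb w0 e0 we; have [r0 r1] := andP rho01.
(* [t <= omega] forces [beta l <= n1], so the last [t] columns contain no forced zeros. *)
have bl (i : 'I_(n1 + t)) (j : 'I_t) : balanced (@Zp_residue p m) rho (mu i (rshift n1 j)).
  have := pb (rshift n1 j) i; rewrite ifT //; apply/existsPn => l.
  by move: (omega_le l) t_omega; rewrite negb_and -!leqNgt /=; lia.
have QQ' (B : 'M[A]_(n1 + t, n1)) D K N : splitting B D K N ->
    forall C, cok_is G (row_mx B C) = cok_is G (N *m C).
  move=> [BKDN NB ND] C; apply/(presentsP p_pr expG)/(presentsP p_pr expG).
    by move/(presents_splitting _ _ BKDN NB ND).
  by move/(presents_splitting _ _ BKDN NB ND).
apply: le_trans (compare_with_uniform (@Zp_nat_bounded p m) (Zp_residue_unit p_pr)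
  (@Zp_residue_surj p m) rho01 pm bl QQ' w0 e0 we) _.
rewrite lerD2r; apply: lerD.
  apply: le_trans _ (stairs_rank_sum_le rho01 omega_le).
  apply: le_trans (expect_rank_lt rho01
    (fr := fun (i : 'I_(n1 + t)) (j : 'I_n1) => ~~ in_stairs alpha beta i j) _ _) _.
  - by move=> i j; exact: pm.
  - by move=> j; exact: (pb (lshift t j)).
  apply: ler_sum => j _.
  rewrite (eq_card (B := [pred i : 'I_(n1 + t) | in_stairs alpha beta i j])) //.
  by move=> i; rewrite !inE negbK.
set z := (1 - rho) / (2 * p%:R).
have p1 : 1 <= p%:R :> R by rewrite ler1n prime_gt0.
have z01 : 0 < z <= 1.
  rewrite divr_gt0 ?subr_gt0 ?mulr_gt0 ?ltr0n ?prime_gt0 //= ler_pdivrMr; last by lra.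
  by lra.
have [z0 _] := andP z01.
have s1 : sigma_rate rho < 1 by rewrite /sigma_rate; lra.
have ls : (1 + #|'F_p|%:R * z) * rho <= sigma_rate rho.
  rewrite card_Fp // /z (_ : p%:R * _ = (1 - rho) / 2); last first.
    by field; rewrite gt_eqF // (lt_le_trans ltr01).
  by rewrite /sigma_rate; nra.
have := stairs_sparse_sum_le rho01 omega_le omega_len w z01 ls s1.
rewrite mulrA [X in X <= _]mulrC -ler_pdivlMr ?mulr_gt0 ?exprn_gt0 //.
apply: le_trans.
have pml i j : is_pmf (mu i (lshift t j)) by exact: pm.
(* Union bound over the sparse nonzero functionals [u]. *)
apply: (@le_trans _ _ (\sum_(u : 'rV['F_p]_(n1 + t) | (u != 0) &&
    (#|[set i | u ord0 i != 0%R]%SET| < w)%N)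
    expect (fun i j => mu i (lshift t j)) (fun B => (u *m map_mx (@Zp_residue p m) B == 0)%:R))).
  rewrite -expect_sum; apply: expect_le => // B.
  case: (boolP (sparsely_annihilated _ _ _)) => [/existsP[u /and3P[u0 uB uw]]|_].
    by rewrite (bigD1 u) /= ?u0 // uB lerDl sumr_ge0.
  by apply: sumr_ge0 => u _; exact: ler0n.
apply: ler_sum => u _; apply: (expect_annihilate_le rho01
    (fr := fun (i : 'I_(n1 + t)) (j : 'I_n1) => ~~ in_stairs alpha beta i j)) => //.
by move=> j; exact: (pb (lshift t j)).
Qed.

End StairsComparison.

(** The order of choices is [t], [e], [w], [omega]: [e] depends on [t], [w] on both, and the
    constant in front of [sigma_rate rho ^+ omega] on [t] and [w], so [omega] comes last and absorbs
    it. *)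
Lemma stairs_error_small (R : realType) (p m k : nat) (rho L e0 : R) (u : nat -> R) :
  prime p -> 0 < rho < 1 -> 0 < e0 -> (u @ \oo --> L)%classic ->
  exists t w omega (e : R), [/\ (0 < w)%N, 0 <= e, (t <= omega)%N,
    near_uniform_cst 'Z_(p ^ m.+1) rho t / w%:R <= e ^+ 2 &
    stairs_error p m k t omega rho w e + `|u t - L| < e0].
Proof.
move=> p_pr rho01 e00 uL; have [r0 r1] := andP rho01.
have geo (x c : R) : 0 <= x < 1 -> forall d, 0 < d ->
    exists N, forall i, (N <= i)%N -> c * x ^+ i < d.
  move=> /andP[x0 x1] d d0.
  have : ((fun i => c * x ^+ i) @ \oo --> (0 : R))%classic.
    rewrite -[X in (_ --> X)%classic](mulr0 c); apply: cvgMr.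
    by apply: cvg_expr; rewrite ger0_norm.
  move=> /cvgrPdist_lt/(_ d d0)[N _ NP]; exists N => i Ni.
  have := NP i Ni; rewrite sub0r normrN; exact: le_lt_trans (ler_norm _).
have r01 : 0 <= rho < 1 by rewrite ltW.
have s01 : 0 <= sigma_rate rho < 1 by rewrite /sigma_rate; apply/andP; split; lra.
(* Five quantities share [e0]: the two halves of the rank term, the sparse term, the distance to
   uniform, and [u t - L]. *)
have d0 : 0 < e0 / 5 by lra.
have [N1 N1P] := geo rho (1 - rho)^-1 r01 _ d0.
have /cvgrPdist_lt/(_ _ d0)[N2 _ N2P] := uL.
pose t := maxn N1 N2.
have ht1 : (1 - rho)^-1 * rho ^+ t < e0 / 5 by apply: N1P; rewrite leq_maxl.
have ht2 : `|u t - L| < e0 / 5 by rewrite distrC; apply: N2P; rewrite /= leq_maxr.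
set a : R := (#|'Z_(p ^ m.+1)| ^ (t * t))%:R.
have a0 : 0 < a by rewrite ltr0n card_Zp_exp // !expn_gt0 prime_gt0.
(* [t.+1] in place of [t] keeps the denominator nonzero when [t = 0]. *)
pose e : R := e0 / 5 / (a * t.+1%:R).
have at0 : 0 < a * t.+1%:R by rewrite mulr_gt0.
have epos : 0 < e by rewrite divr_gt0.
have he : a * (t%:R * e) <= e0 / 5.
  have -> : e0 / 5 = a * t.+1%:R * e by rewrite /e [RHS]mulrC divfK // gt_eqF.
  rewrite -mulrA ler_wpM2l ?(ltW a0) // ler_wpM2r ?(ltW epos) //.
  by rewrite ler_nat.
pose K := near_uniform_cst 'Z_(p ^ m.+1) rho t.
have K0 : 0 <= K.
  by rewrite /K /near_uniform_cst !mulr_ge0 ?exprn_ge0 // invr_ge0 subr_ge0 ltW.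
pose w := (Num.truncn (K / e ^+ 2)).+1.
have hw : K / w%:R <= e ^+ 2.
  rewrite ler_pdivrMr ?ltr0n // mulrC -ler_pdivrMr ?exprn_gt0 //.
  by apply/ltW; rewrite /w truncnS_gt.
pose C := (1 + (1 - sigma_rate rho)^-1) / (((1 - rho) / (2 * p%:R)) ^+ w * rho ^+ t).
have [N3 N3P] := geo rho (k%:R / (1 - rho)) r01 _ d0.
have [N4 N4P] := geo (sigma_rate rho) C s01 _ d0.
pose omega := maxn t (maxn N3 N4).
have ho3 : k%:R / (1 - rho) * rho ^+ omega < e0 / 5.
  by apply: N3P; rewrite /omega !leq_max leqnn orbT.
have ho4 : C * sigma_rate rho ^+ omega < e0 / 5.
  by apply: N4P; rewrite /omega !leq_max leqnn !orbT.
exists t, w, omega, e; split=> //; first exact: ltW.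
  by rewrite /omega leq_maxl.
rewrite /stairs_error -/a.
have -> : (k%:R * rho ^+ omega + rho ^+ t) / (1 - rho) =
    k%:R / (1 - rho) * rho ^+ omega + (1 - rho)^-1 * rho ^+ t.
  by rewrite mulrDl mulrAC [rho ^+ t * _]mulrC.
have -> : sigma_rate rho ^+ omega * (1 + (1 - sigma_rate rho)^-1) /
     (((1 - rho) / (2 * p%:R)) ^+ w * rho ^+ t) = C * sigma_rate rho ^+ omega.
  by rewrite -mulrA mulrC.
by move: ht1 ht2 he ho3 ho4; lra.
Qed.

(** * Passage to the limit in the size of the matrix *)

Local Open Scope classical_set_scope.

Theorem theorem7p3 (R : realType) (p : nat) (eps : R) (k : nat)
    (alpha beta : nat -> 'I_k -> nat)
    (d : nat -> measure_display) (T : forall n, measurableType (d n))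
    (P : forall n, probability (T n) R)
    (M : forall n, T n -> 'M[padic p]_n) :
  prime p -> 0 < eps < 1 -> (0 < k)%N ->
  (forall n, (k <= n)%N -> stair_indices n (alpha n) (beta n)) ->
  (forall n, (k <= n)%N ->
     eps_balanced_stairs_matrix (P n) eps (alpha n) (beta n) (@M n)) ->
  (forall l : 'I_k,
     (n%:R - (alpha n l)%:R - (beta n l)%:R : R) @[n --> \oo] --> +oo) ->
  forall G : finZmodType, (p.-group [set: G]%SET)%g ->
    P n [set t | zmod_isog (cok (M n t)) G] @[n --> \oo] -->
      ((#|Aut [set: G]%SET|%:R)^-1 *
         limn (fun N => \prod_(1 <= i < N.+1) (1 - p%:R ^- i) : R))%:E.
Proof.
move=> p_pr /andP[eps0 eps1] k0 _ HM Hinf G pG.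
have rho01 : 0 < 1 - eps < 1 by apply/andP; split; lra.
(* The order of [G] is some [p ^ m], and it kills [G] by Lagrange's theorem. *)
have [m expG] : exists m, forall g : G, g *+ (p ^ m) = 0.
  have /p_natP[m cG] := pG; exists m => g.
  rewrite -cG -[g *+ _]/((g : G) ^+ #|[set: G]%SET|)%g.
  by apply: expg_cardG; rewrite inE.
set L := _^-1 * _.
have law_cvg := @uniform_cok_cvg p m G p_pr expG R.
pose prob n := expect (@entry_law _ _ R (P n) p m n (@M n)) (fun X => (cok_is G X)%:R).
(* For [n >= k] the probabilities are the real numbers [prob n], and a limit depends only on the
   tail. *)
suff prob_cvg : prob @ \oo --> L.
  have /near_eq_cvg/cvg_trans : {near \oo, (EFin \o prob) =1
      (fun n => P n [set t | zmod_isog (cok (M n t)) G])}.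
    near=> n; have kn : (k <= n)%N by near: n; exact: nbhs_infty_ge.
    by rewrite /= (stairs_event_prob p_pr (HM n kn) expG).
  by apply; apply: cvg_EFin; [exact: nearW|exact: prob_cvg].
apply/cvgrPdist_lt => e0 e00.
have [t [w [omega [e [w0 e0' t_omega hw small]]]]] :=
  stairs_error_small m k p_pr rho01 e00 law_cvg.
(* There are finitely many steps, so one threshold on [n] serves them all. *)
have gap : \forall n \near \oo, forall l : 'I_k,
    (omega%:R : R) <= n%:R - (alpha n l)%:R - (beta n l)%:R.
  by apply: filter_forall => l; have /cvgryPge := Hinf l; apply.
near=> n.
have kn : (k <= n)%N by near: n; exact: nbhs_infty_ge.
have gapn : forall l, (omega%:R : R) <= n%:R - (alpha n l)%:R - (beta n l)%:R.
  by near: n; exact: gap.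
have omega_le l : (alpha n l + beta n l + omega <= n)%N.
  have : (omega%:R : R) <= n%:R - (alpha n l)%:R - (beta n l)%:R by exact: gapn.
  by rewrite -addrA -opprD lerBrDr -!natrD ler_nat addnC.
(* Positivity of [k] supplies a step from which to read [omega <= n]. *)
have omega_len : (omega <= n)%N.
  exact: leq_trans (leq_addl _ _) (omega_le (Ordinal k0)).
have tn : (t <= n)%N by exact: leq_trans omega_len.
have pm := entry_law_pmf m (HM n kn).
have pb := entry_law_partly_balanced m p_pr (HM n kn).
apply: le_lt_trans small.
rewrite (_ : L - prob n = (uniform_prob R (@cok_is p m G t) - prob n) -
    (uniform_prob R (@cok_is p m G t) - L)); last by ring.
apply: le_trans (ler_normB _ _) _; rewrite lerD2r distrC.
(* Rewriting the size as [n - t + t] separates the last [t] columns. *)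
have nE : n = (n - t + t)%N by rewrite subnK.
rewrite /prob; move: omega_le omega_len pm pb.
move: (alpha n) (beta n) (@entry_law _ _ R (P n) p m n (@M n)).
rewrite nE => al be mu ole olen pm pb.
exact: (stairs_compare p_pr rho01 expG ole olen t_omega pm pb w0 e0' hw).
Unshelve. all: by end_near.
Qed.
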